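(* Let $n\ge 3$ and let $f:S^{n-1}\to\mathbb{R}$ be a continuous function such that for every $u\in S^{n-1}$ the restriction $f|_{S^{n-1}\cap u^{\perp}}$ is completely symmetric (as a function on the unit sphere $S^{n-1}\cap u^\perp$ of the $(n-1)$-dimensional Euclidean space $u^{\perp}$). Then $f$ is constant.
   Context: $S^{n-1}$ is the unit sphere of $\mathbb{R}^n$ with the standard scalar product $\langle\cdot,\cdot\rangle$, and $u^\perp=\{x\in\mathbb{R}^n:\langle x,u\rangle=0\}$. The sets $S^{n-1}\cap u^\perp$ are called equators. For a finite-dimensional Euclidean space $H$ (e.g. $\mathbb{R}^n$ or a linear subspace of it), $ISO(H)$ denotes the group of all isometries of $H$ and $O(H)$ the group of linear isometries; $S_H$ denotes the unit sphere of $H$, with its usual volume measure $dx$. For a set $K\subseteq H$, its symmetry group is $Sym(K)=\{T\in ISO(H):TK=K\}$; for $g:S_H\to\mathbb{R}$, its symmetry group is $Sym(g)=\{T\in O(H): g(Tx)=g(x)\text{ for all }x\in S_H\}$. A subgroup $G$ of $ISO(H)$ is called complete if every ellipsoid in $H$ (with non-empty interior in $H$) whose symmetry group contains $G$ is a ball of $H$. A function $g:S_H\to\mathbb{R}$ is called completely symmetric if its centroid is at the origin, i.e. $\int_{S_H}x\,g(x)\,dx=0$, and its symmetry group $Sym(g)$ is complete. *)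

(* Defs.v *)
From HB Require Import structures.
From mathcomp Require Import all_boot all_order all_algebra.
From mathcomp Require Import all_classical all_reals all_analysis.
Import Order.TTheory GRing.Theory Num.Theory.
Import numFieldNormedType.Exports.

Set Implicit Arguments.
Unset Strict Implicit.
Unset Printing Implicit Defensive.

Local Open Scope classical_set_scope.
Local Open Scope ring_scope.

Section Euclid.
Context {R : realType} {n : nat}.
Implicit Types x y u : 'rV[R]_n.

Definition dot x y : R := \sum_(i < n) x 0 i * y 0 i.

(* Not the library norm [`|x|] on matrices, which is the maximum norm. *)
Definition enorm x : R := Num.sqrt (dot x x).

Definition sphere : set 'rV[R]_n := [set x | enorm x = 1].

Definition perp u : {vspace 'rV[R]_n} := lker (linfun (mulmxr u^T)).

Lemma mem_perp u x : (x \in perp u) = (dot x u == 0).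
Proof.
rewrite memv_ker lfunE /=; have -> : dot x u = (x *m u^T) 0 0.
  by rewrite mxE; apply: eq_bigr => i _; rewrite mxE.
apply/eqP/eqP => [->|xu0]; first by rewrite mxE.
by apply/rowP => i; rewrite (ord1 i) xu0 mxE.
Qed.

End Euclid.

Section Hausdorff.
Context {R : realType}.
Local Open Scope ereal_scope.

(* Volume of the unit ball of an s-dimensional Euclidean space, by the
   recursion vol(s+2) = 2 pi / (s+2) * vol(s). *)
Fixpoint ball_volume (s : nat) : R :=
  match s with
  | 0%N => 1%R
  | 1%N => 2%R
  | s'.+2 => (2 * pi / s'.+2%:R * ball_volume s')%R
  end.

Lemma ball_volume_ge0 s : (0 <= ball_volume s)%R.
Proof.
suff : (0 <= ball_volume s)%R /\ (0 <= ball_volume s.+1)%R by case.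
elim: s => [|s [IH0 IH1]]; first by split => //=; exact: ler0n.
by split => //=; rewrite mulr_ge0// divr_ge0// mulr_ge0// pi_ge0.
Qed.

Context {T : Type} (dist : T -> T -> R) (s : nat).
Implicit Types (A B : set T) (e : R).

(* Bounded below by 0 so that the empty set has diameter 0. *)
Definition diameter A : \bar R :=
  ereal_sup (0 |` [set (dist p.1 p.2)%:E | p in A `*` A]).

(* The empty set must have weight 0 also when s = 0. *)
Definition hausdorff_weight A : \bar R :=
  if `[< A = set0 >] then 0
  else (ball_volume s / 2 ^+ s)%:E * diameter A ^+ s.

Definition hausdorff_cover e A : set ((set T)^nat) :=
  [set F | (forall k, diameter (F k) <= e%:E) /\ A `<=` \bigcup_k F k].

Definition hausdorff_content e A : \bar R :=
  ereal_inf [set \sum_(k <oo) hausdorff_weight (F k)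
            | F in hausdorff_cover e A].

(* The s-dimensional Hausdorff outer measure of (T, dist), normalised so as to
   agree with the s-dimensional volume. *)
Definition hausdorff A : \bar R :=
  ereal_sup [set hausdorff_content e A | e in [set e | (0 < e)%R]].

Lemma diameter_ge0 A : 0 <= diameter A.
Proof. by apply: ereal_sup_ubound; left. Qed.

Lemma diameter_set0 : diameter set0 = 0.
Proof.
rewrite /diameter; have -> : set0 `*` set0 = set0 :> set (T * T).
  by apply/seteqP; split => -[x y] //= [].
by rewrite image_set0 setU0 ereal_sup1.
Qed.

Lemma hausdorff_weight_ge0 A : 0 <= hausdorff_weight A.
Proof.
rewrite /hausdorff_weight; case: asboolP => // _.
rewrite mule_ge0 ?expe_ge0 ?diameter_ge0//.
by rewrite lee_fin divr_ge0 ?ball_volume_ge0 ?exprn_ge0.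
Qed.

Lemma hausdorff_weight_set0 : hausdorff_weight set0 = 0.
Proof. by rewrite /hausdorff_weight; case: asboolP. Qed.

Lemma hausdorff_content_ge0 e A : 0 <= hausdorff_content e A.
Proof.
apply: le_ereal_inf_tmp => _ [F _ <-].
by apply: nneseries_ge0 => k _ _; exact: hausdorff_weight_ge0.
Qed.

Lemma hausdorff_content_sigma_subadditive e A (F : (set T)^nat) :
  A `<=` \bigcup_i F i ->
  hausdorff_content e A <= \sum_(i <oo) hausdorff_content e (F i).
Proof.
move=> AF; set mu := hausdorff_content e.
have [[i ioo]|] := pselect (exists i, mu (F i) = +oo).
  rewrite (eseries_pinfty _ _ ioo) ?leey// => k _.
  by rewrite -ltNye (lt_le_trans _ (hausdorff_content_ge0 _ _)).
rewrite -forallNE => Foo; apply/lee_addgt0Pr => d d0.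
apply: le_trans (epsilon_trick xpredT _ (ltW d0)); last first.
  by move=> k; exact: hausdorff_content_ge0.
pose P k (B : (set T)^nat) := hausdorff_cover e (F k) B /\
  \sum_(i <oo) hausdorff_weight (B i) <= mu (F k) + (d / (2 ^ k.+1)%:R)%:E.
have [G PG] : {G : ((set T)^nat)^nat & forall k, P k (G k)}.
  apply: (@boolp.choice _ _ P).
  move=> k.
  have dk : (0 < d / (2 ^ k.+1)%:R)%R by rewrite divr_gt0// ltr0n expn_gt0.
  have fk : mu (F k) \is a fin_num.
    rewrite ge0_fin_numE; last exact: hausdorff_content_ge0.
    by rewrite ltey; exact/eqP.
  have [_ [B BF <-] /ltW lB] := lb_ereal_inf_adherent dk fk.
  by exists B.
apply: (@le_trans _ _ (\esum_(p in setT) (hausdorff_weight \o uncurry G) p)).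
  have /card_esym/ppcard_eqP[f] := card_nat2.
  apply: ereal_inf_lbound => /=; exists (uncurry G \o f).
    split => [i|t /AF[i _ Fit]].
      by rewrite /= /uncurry; case: (f i) => a b; exact: (PG a).1.1.
    have [j _ Gt] := (PG i).1.2 t Fit.
    by exists (f^-1%FUN (i, j)) => //=; rewrite invK ?inE.
  rewrite -(esum_pred_image (hausdorff_weight \o uncurry G) _ xpredT)
    ?[fun=> _]set_true//.
    by rewrite image_eq.
  by move=> p _; exact: hausdorff_weight_ge0.
rewrite [leLHS](_ : _ = \sum_(i <oo) \sum_(j <oo) hausdorff_weight (G i j)).
  apply: lee_nneseries => i _; last exact: (PG i).2.
  by move=> _; apply: nneseries_ge0 => *; exact: hausdorff_weight_ge0.
pose J i : set (nat * nat) := [set (i, j) | j in setT].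
rewrite (_ : setT = \bigcup_k J k); last first.
  by rewrite predeqE => -[a b]; split => // _; exists a => //; exists b.
rewrite esum_bigcupT /=; last 2 first.
- apply/trivIsetP => i j _ _ ij.
  rewrite predeqE => -[k m] /=; split => //= -[] [_] _ [<-{k} _].
  by move=> [m' _] [] /esym/eqP; rewrite (negbTE ij).
- by move=> p; exact: hausdorff_weight_ge0.
rewrite -(image_id [set: nat]) -fun_true esum_pred_image//; last first.
  by move=> k _; apply: esum_ge0 => *; exact: hausdorff_weight_ge0.
apply: eq_eseriesr => /= j _.
rewrite -(esum_pred_image (hausdorff_weight \o uncurry G) (pair j) predT)//=.
- by congr esum; rewrite predeqE => -[a b]; split; move=> [i _ <-]; exists i.
- by move=> k _; exact: hausdorff_weight_ge0.
- by move=> ? ? _ _; exact: (@can_inj _ _ _ snd).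
Qed.

Lemma hausdorff0 : hausdorff set0 = 0.
Proof.
apply/eqP; rewrite eq_le; apply/andP; split.
  apply: ge_ereal_sup => _ [e /= e0 <-].
  apply: ereal_inf_lbound; exists (fun=> set0).
    by split => // k; rewrite diameter_set0 lee_fin ltW.
  by apply: eseries0 => k _ _; exact: hausdorff_weight_set0.
by apply: le_trans (hausdorff_content_ge0 1 set0) _;
  apply: ereal_sup_ubound; exists 1%R => //=.
Qed.

Lemma hausdorff_ge0 A : 0 <= hausdorff A.
Proof.
by apply: le_trans (hausdorff_content_ge0 1 A) _;
  apply: ereal_sup_ubound; exists 1%R => //=.
Qed.

Lemma hausdorff_sigma_subadditive A F : subset_sigma_subadditive hausdorff A F.
Proof.
move=> AF; apply: ge_ereal_sup => _ [e /= e0 <-].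
apply: le_trans (hausdorff_content_sigma_subadditive e AF) _.
apply: lee_nneseries => i _; first by move=> _; exact: hausdorff_content_ge0.
by apply: ereal_sup_ubound; exists e.
Qed.

HB.instance Definition _ := isSubsetOuterMeasure.Build R T hausdorff
  hausdorff0 hausdorff_ge0 hausdorff_sigma_subadditive.

End Hausdorff.

Section Symmetry.
Context {R : realType} {n : nat} (H : {vspace 'rV[R]_n}).

HB.instance Definition _ := isPointed.Build (subvs_of H) 0.

Implicit Types (x y c : subvs_of H) (E K B : set (subvs_of H)).
Implicit Types (T : subvs_of H -> subvs_of H).
Implicit Types (G : set (subvs_of H -> subvs_of H)) (g : subvs_of H -> R).

Definition edist x y : R := enorm (vsval (x - y)).

Definition eball c (r : R) : set (subvs_of H) := [set x | edist x c <= r].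

Definition unit_sphere : set (subvs_of H) := [set x | enorm (vsval x) = 1].

Definition ISO : set (subvs_of H -> subvs_of H) :=
  [set T | bijective T /\ forall x y, edist (T x) (T y) = edist x y].

Definition OG : set (subvs_of H -> subvs_of H) := [set T | ISO T /\ linear T].

Definition iso_subgroup G : Prop :=
  [/\ G `<=` ISO, G id, (forall S T, G S -> G T -> G (S \o T)) &
      forall S T, G S -> cancel S T -> cancel T S -> G T].

Definition sym_set K : set (subvs_of H -> subvs_of H) :=
  [set T | ISO T /\ T @` K = K].

(* Only the values of g on the unit sphere matter. *)
Definition sym_fun g : set (subvs_of H -> subvs_of H) :=
  [set T | OG T /\ forall x, unit_sphere x -> g (T x) = g x].

(* Affine images of the unit ball, possibly degenerate. *)
Definition ellipsoid E : Prop :=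
  exists c (L : 'End(subvs_of H)), E = [set c + L x | x in eball 0 1].

Definition has_interior E : Prop :=
  exists c, exists2 r : R, 0 < r & eball c r `<=` E.

Definition is_ball B : Prop := exists c, exists2 r : R, 0 < r & B = eball c r.

Definition complete_group G : Prop :=
  iso_subgroup G /\
  forall E, ellipsoid E -> has_interior E -> G `<=` sym_set E -> is_ball E.

(* The volume measure of the unit sphere of H.  Hausdorff measure is a metric
   outer measure, so its Caratheodory sigma-algebra contains the Borel sets. *)
Definition surface := hausdorff edist (\dim H).-1.

Definition centered g : Prop := forall i : 'I_n,
  (\int[(surface : set (caratheodory_type surface) -> \bar R)]_(x in unit_sphere)
     (vsval x 0 i * g x)%:E = 0)%E.

Definition completely_symmetric g : Prop :=
  centered g /\ complete_group (sym_fun g).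

Lemma edist_linear T : linear T -> ISO T <->
  bijective T /\ forall x, enorm (vsval (T x)) = enorm (vsval x).
Proof.
move=> lT; have TB x y : T (x - y) = T x - T y.
  by rewrite -scaleN1r addrC lT scaleN1r addrC.
have T0 : T 0 = 0 by rewrite -[in LHS](subrr 0) TB subrr.
split=> -[bT dT]; split=> // x; last by move=> y; rewrite /edist -TB dT.
by have := dT x 0; rewrite T0 /edist !subr0.
Qed.

Lemma sym_fun_subgroup g : iso_subgroup (sym_fun g).
Proof.
split.
- by move=> T [[]].
- by split=> //; split=> //; split=> //; exists id.
- move=> S T [[[bS dS] lS] gS] [[[bT dT] lT] gT].
  have nT := ((edist_linear lT).1 (conj bT dT)).2.
  split; last by move=> x x1 /=; rewrite gS ?gT// /unit_sphere /= nT.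
  split; last by move=> a x y /=; rewrite lT lS.
  by split; [exact: bij_comp | move=> x y /=; rewrite dS dT].
- move=> S T [[[bS dS] lS] gS] ST TS.
  have nS := ((edist_linear lS).1 (conj bS dS)).2.
  split; last first.
    by move=> x x1; rewrite -{2}(TS x) gS// /unit_sphere /= -nS TS.
  split; last by move=> a x y; apply: (can_inj ST); rewrite lS !TS.
  by split; [exists S | move=> x y; rewrite -dS !TS].
Qed.

End Symmetry.

(* Main.v *)
(** The group [Sym f] of a section acts irreducibly on the hyperplane of the
    section, so for every unit vector [u] the first moment of [f] on the equator
    orthogonal to [u] vanishes and its second moment form is a multiple of the
    scalar product of [u^perp].  Fix a unit vector [x] and let [(a, b)] be a
    random orthonormal pair (two rows of a Haar-distributed orthogonal matrix),
    with [p = <a, x>] and [q = <b, x>].  Taking [u = b] and integrating against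
    [q^j] gives [E(f(a) p q^j) = 0] and
    [E(f(a) ((n - 1) p^2 - (1 - q^2)) q^j) = 0].  Given [a], [q] is distributed
    as [sqrt (1 - p^2)] times a variable independent of [a], so after subtracting
    from [f] its mean these identities force [E(f(a) p^k) = 0] for all [k]; the
    weights [(1 + p)^N] then concentrate at [a = x] and give [f x = 0].

    Only means of uniformly continuous functions are needed.  They are obtained
    by von Neumann's method, as the only constant that is a uniform limit of
    averages of translates. *)
From HB Require Import structures.
Require Import Defs.
From mathcomp Require Import all_boot all_order all_algebra.
From mathcomp Require Import all_classical all_reals all_analysis.
From mathcomp Require Import lra.
Import Order.TTheory GRing.Theory Num.Theory.
Import numFieldNormedType.Exports.

Set Implicit Arguments.
Unset Strict Implicit.
Unset Printing Implicit Defensive.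

Local Open Scope classical_set_scope.
Local Open Scope ring_scope.

(** * Haar means by averaging *)

Section Average.
Context {R : realType}.

Definition ave (I : finType) (F : I -> R) : R := (\sum_i F i) / #|I|%:R.

Lemma eq_ave (I : finType) (F G : I -> R) : F =1 G -> ave F = ave G.
Proof. by move=> FG; congr (_ / _); apply: eq_bigr => i _. Qed.

Lemma ave_cst (I : finType) (a : R) : (0 < #|I|)%N -> ave (fun _ : I => a) = a.
Proof.
move=> I0; rewrite /ave sumr_const -[a *+ _]mulr_natr mulfK//.
by rewrite pnatr_eq0 -lt0n.
Qed.

Lemma aveD (I : finType) (F G : I -> R) :
  ave (fun i => F i + G i) = ave F + ave G.
Proof. by rewrite /ave big_split mulrDl. Qed.

Lemma aveZ (I : finType) a (F : I -> R) : ave (fun i => a * F i) = a * ave F.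
Proof. by rewrite /ave -mulr_sumr mulrA. Qed.

Lemma ave_exchange (I J : finType) (F : I -> J -> R) :
  ave (fun i => ave (F i)) = ave (fun j => ave (fun i => F i j)).
Proof.
rewrite /ave -!mulr_suml exchange_big -!mulrA; congr (_ * _).
by rewrite mulrC.
Qed.

Lemma ave_pair (I J : finType) (F : I -> J -> R) :
  ave (fun i => ave (F i)) = ave (fun p : I * J => F p.1 p.2).
Proof.
by rewrite /ave -mulr_suml pair_big /= -mulrA card_prod natrM invfM [in RHS]mulrC
  mulrC [in RHS](mulrC (_^-1)).
Qed.

Lemma ler_ave (I : finType) (F G : I -> R) :
  (forall i, F i <= G i) -> ave F <= ave G.
Proof. by move=> FG; rewrite ler_wpM2r ?invr_ge0 ?ler0n// ler_sum. Qed.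

Lemma ave_bound (I : finType) (F : I -> R) a b : (0 < #|I|)%N ->
  (forall i, a <= F i <= b) -> a <= ave F <= b.
Proof.
move=> I0 F_ab; rewrite -{1}(ave_cst a I0) -{1}(ave_cst b I0).
by rewrite !ler_ave// => i; case/andP: (F_ab i).
Qed.

Lemma ave_dist (I : finType) (F : I -> R) a e : (0 < #|I|)%N ->
  (forall i, `|F i - a| <= e) -> `|ave F - a| <= e.
Proof.
by move=> I0 Fa; rewrite ler_distl; apply: ave_bound => // i; rewrite -ler_distl.
Qed.

Lemma ave_dist2 (I : finType) (F G : I -> R) e : (0 < #|I|)%N ->
  (forall i, `|F i - G i| <= e) -> `|ave F - ave G| <= e.
Proof.
move=> I0 FG; rewrite -mulN1r -aveZ -aveD -[X in `|X|]subr0.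
by apply: ave_dist => // i; rewrite subr0 mulN1r.
Qed.

(** Quantitative gain in one round of [lave_oscillation]: at each point some unspecified translate
    lies low, which lowers the average by a fixed share. *)
Lemma ave_le_gap (I : finType) (F : I -> R) b m i0 :
  (forall i, F i <= b) -> F i0 <= b - m -> ave F <= b - m / #|I|%:R.
Proof.
move=> Fb Fi0; have I0 : (0 < #|I|)%N by apply/card_gt0P; exists i0.
have cI : 0 < #|I|%:R :> R by rewrite ltr0n.
rewrite ler_pdivrMr// mulrBl divfK ?gt_eqF//.
rewrite (bigD1 i0)//= mulr_natr -sumr_const [X in _ <= X - m](bigD1 i0)//=.
rewrite addrAC lerD//; exact: ler_sum.
Qed.

Lemma expr_small (q : R) (a e : R) : 0 <= q < 1 -> 0 < e ->
  exists N : nat, a * q ^+ N <= e.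
Proof.
move=> /andP[q0 q1] e0.
have /cvgrPdist_le : (fun N => a * q ^+ N) @ \oo --> (a * 0 : R).
  by apply: cvgM; [exact: cvg_cst | apply: cvg_expr; rewrite ger0_norm].
move=> /(_ e e0)[N _ /(_ N (leqnn N))]; rewrite mulr0 sub0r normrN => H.
by exists N; rewrite (le_trans _ H)// ler_norm.
Qed.

End Average.

(* The gauge is a bi-invariant (not necessarily subadditive) distance; the
   Haar mean is defined on functions that are uniformly continuous for it. *)
Record bounded_group (R : realType) := BoundedGroup {
  bg_sort :> Type;
  bg_mul : bg_sort -> bg_sort -> bg_sort;
  bg_one : bg_sort;
  bg_inv : bg_sort -> bg_sort;
  gauge : bg_sort -> bg_sort -> R;
  bg_mulA : associative bg_mul;
  bg_mul1g : left_id bg_one bg_mul;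
  bg_mulg1 : right_id bg_one bg_mul;
  bg_mulVg : left_inverse bg_one bg_inv bg_mul;
  bg_mulgV : right_inverse bg_one bg_inv bg_mul;
  gaugeMl : forall k x y, gauge (bg_mul k x) (bg_mul k y) = gauge x y;
  gaugeMr : forall k x y, gauge (bg_mul x k) (bg_mul y k) = gauge x y;
  gauge_totally_bounded : forall e : R, 0 < e ->
    exists (I : finType) (c : I -> bg_sort), forall x, exists i, gauge x (c i) <= e
}.

(** Left and right averages swap here, so results on left averages transfer to right ones. *)
Definition opposite_group (R : realType) (G : bounded_group R) :=
  @BoundedGroup R G (fun x y => bg_mul y x) (bg_one G) (@bg_inv R G)
    (@gauge R G) (fun x y z => esym (bg_mulA z y x)) (@bg_mulg1 R G)
    (@bg_mul1g R G) (@bg_mulgV R G) (@bg_mulVg R G) (@gaugeMr R G)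
    (@gaugeMl R G) (@gauge_totally_bounded R G).

(** * Existence and properties of the two-sided mean *)

Section HaarMean.
Context {R : realType}.
Implicit Type G : bounded_group R.

Definition ucont G (F : G -> R) := forall e : R, 0 < e ->
  exists2 d : R, 0 < d & forall x y, gauge x y <= d -> `|F x - F y| <= e.

Definition lave G (I : finType) (c : I -> G) (F : G -> R) : G -> R :=
  fun g => ave (fun i => F (bg_mul (c i) g)).

Definition rave G (I : finType) (c : I -> G) (F : G -> R) : G -> R :=
  fun g => ave (fun i => F (bg_mul g (c i))).

Definition lmean G (F : G -> R) (m : R) := forall e : R, 0 < e ->
  exists (I : finType) (c : I -> G),
    (0 < #|I|)%N /\ forall g, `|lave c F g - m| <= e.

Definition rmean G (F : G -> R) (m : R) := forall e : R, 0 < e ->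
  exists (I : finType) (c : I -> G),
    (0 < #|I|)%N /\ forall g, `|rave c F g - m| <= e.

Definition mean G (F : G -> R) (m : R) := lmean F m /\ rmean F m.

(** The value is 0 if there is no mean; [mean_exists] rules this out for uniformly continuous
    functions. *)
Definition haar G (F : G -> R) : R := xget 0 [set m | mean F m].

Lemma lave_rave G (I J : finType) (c : I -> G) (c' : J -> G) F :
  lave c (rave c' F) =1 rave c' (lave c F).
Proof.
move=> g; rewrite /lave /rave ave_exchange.
by apply: eq_ave => j; apply: eq_ave => i; rewrite bg_mulA.
Qed.

Lemma lave_comp G (I J : finType) (c : I -> G) (c' : J -> G) F :
  lave c' (lave c F) =1 lave (fun p : J * I => bg_mul (c p.2) (c' p.1)) F.
Proof.
move=> g; rewrite /lave ave_pair.
by apply: eq_ave => j; rewrite bg_mulA.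
Qed.

Lemma ucont_lave G (I : finType) (c : I -> G) F :
  (0 < #|I|)%N -> ucont F -> ucont (lave c F).
Proof.
move=> I0 uF e e0; have [d d0 dF] := uF e e0; exists d => // x y xy.
by apply: ave_dist2 => // i; apply: dF; rewrite gaugeMl.
Qed.

(** If [c i] is a net, left translation by [x0 (c i)^-1] carries the points near [c i] to points
    near [x0]. The index type is fixed before [x0], so the number of translates depends on [d]
    only. *)
Lemma translate_cover G (d : R) : 0 < d ->
  exists2 I : finType, (0 < #|I|)%N & forall x0 : G, exists c : I -> G,
    forall g, exists i, gauge (bg_mul (c i) g) x0 <= d.
Proof.
move=> d0; have [I [c cd]] := gauge_totally_bounded G d0; exists I.
  by have [i _] := cd (bg_one G); apply/card_gt0P; exists i.
move=> x0; exists (fun i => bg_mul x0 (bg_inv (c i))) => g.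
have [i gi] := cd g; exists i.
by rewrite -[X in gauge _ X](bg_mulg1 x0) -(bg_mulVg (c i)) bg_mulA gaugeMl.
Qed.

Lemma ucont_bounded G (F : G -> R) : ucont F ->
  exists2 K : R, 0 < K & forall g, `|F g| <= K.
Proof.
move=> /(_ 1 ltr01)[d d0 dF].
have [I [c cd]] := gauge_totally_bounded G d0.
exists (1 + \sum_i `|F (c i)|); first by rewrite ltr_pwDl// sumr_ge0.
move=> g; have [i gi] := cd g.
rewrite -[F g](subrK (F (c i))) (le_trans (ler_normD _ _))//.
by rewrite lerD ?dF// (bigD1 i)//= lerDl sumr_ge0.
Qed.

(* Averaging over translations that bring every point close to a place where
   [F] is small shrinks the oscillation by a factor which depends only on the
   modulus of continuity, and averages inherit that modulus. *)
Lemma lave_oscillation G (F : G -> R) e : ucont F -> 0 < e ->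
  exists (I : finType) (c : I -> G) (a : R),
    (0 < #|I|)%N /\ forall g, a <= lave c F g <= a + e.
Proof.
move=> uF e0.
have e4 : 0 < e / 4 by rewrite divr_gt0.
have [d d0 dF] := uF _ e4.
have [J J0 cover] := translate_cover G d0.
(* One round shrinks the oscillation by the factor [q]: among [#|J|] translates, one lies a quarter
   of the oscillation below the upper bound. *)
pose q : R := 1 - (4 * #|J|%:R)^-1.
have J1 : 1 <= #|J|%:R :> R by rewrite ler1n.
have q01 : 0 <= q < 1.
  rewrite /q subr_ge0 ltrBlDr ltrDl invr_gt0 mulr_gt0 ?ltr0n// andbT.
  by rewrite invf_le1 ?mulr_gt0 ?ltr0n//; lra.
have [K K0 FK] := ucont_bounded uF.
have [N KN] := expr_small (2 * K) q01 e0.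
suff H M : exists (I : finType) (c : I -> G) (a b : R), [/\ (0 < #|I|)%N,
    (forall g, a <= lave c F g <= b) & b - a <= e \/ b - a <= 2 * K * q ^+ M].
  have [I [c [a [b [I0 ab H1]]]]] := H N; exists I, c, a; split => // g.
  have {H1} ba : b - a <= e by case: H1 => // /le_trans; apply.
  by have /andP[-> /le_trans->]//= := ab g; lra.
elim: M => [|M [I [c [a [b [I0 ab H]]]]]].
  exists unit, (fun=> bg_one G), (- K), K; rewrite card_unit; split=> //.
    move=> g; apply: ave_bound; rewrite ?card_unit// => i.
    by rewrite -ler_norml.
  by right; rewrite expr0; lra.
have [bae|eba] := lerP (b - a) e; first by exists I, c, a, b; split => //; left.
have {}H : b - a <= 2 * K * q ^+ M by case: H => // ?; lra.
have qbound : (b - a) * q <= 2 * K * q ^+ M.+1.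
  by rewrite exprSr mulrA ler_wpM2r//; case/andP: q01.
(* If no value lies in the lower half, the midpoint is already a better lower bound for the same
   average. *)
have [[x0 Fx0]|/forallNP big] :=
    pselect (exists x0, lave c F x0 <= (a + b) / 2); last first.
  exists I, c, ((a + b) / 2), b; split=> //.
    move=> g; have /negP := big g; rewrite -ltNge => /ltW ->.
    by case/andP: (ab g).
  right; apply: le_trans qbound; rewrite /q.
  have : (4 * #|J|%:R)^-1 <= 2^-1 :> R.
    by rewrite lef_pV2 ?posrE ?mulr_gt0 ?ltr0n//; lra.
  have : 0 < b - a by lra.
  set t := _^-1; move=> *; nra.
have [c' c'd] := cover x0.
exists (J * I)%type, (fun p => bg_mul (c p.2) (c' p.1)), a,
  (b - (b - a) / 4 / #|J|%:R).
split; first by rewrite card_prod muln_gt0 J0.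
  move=> g; rewrite -lave_comp; apply/andP; split.
    by have /andP[] := ave_bound J0 (fun i => ab (bg_mul (c' i) g)).
  have [i ix0] := c'd g; apply: (ave_le_gap (i0 := i)).
    by move=> j; case/andP: (ab (bg_mul (c' j) g)).
  (* As [e < b - a], a value this close to the one at [x0] is at most
     [(a + b) / 2 + e / 4 <= b - (b - a) / 4]. *)
  have : `|lave c F (bg_mul (c' i) g) - lave c F x0| <= e / 4.
    by apply: ave_dist2 => // j; apply: dF; rewrite gaugeMl.
  by rewrite ler_distl => /andP[_ ?]; lra.
right; apply: le_trans qbound; rewrite /q invfM; set t := #|J|%:R^-1; lra.
Qed.

(** Left and right averaging commute, so the double average is close to both constants at once. *)
Lemma lmean_rmean_unique G (F : G -> R) m m' :
  lmean F m -> rmean F m' -> m = m'.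
Proof.
move=> lm rm; apply/eqP; rewrite -subr_eq0 -normr_le0.
apply/ler_addgt0Pr => e e0; rewrite add0r.
have e2 : 0 < e / 2 by rewrite divr_gt0.
have [I [c [I0 cm]]] := lm _ e2; have [J [c' [J0 cm']]] := rm _ e2.
have h1 : `|lave c (rave c' F) (bg_one G) - m'| <= e / 2 by apply: ave_dist.
have h2 : `|lave c (rave c' F) (bg_one G) - m| <= e / 2.
  by rewrite lave_rave; apply: ave_dist.
by move: h1 h2; rewrite !ler_distl => /andP[? ?] /andP[? ?]; apply/andP; lra.
Qed.

(** The mean is the supremum of the constants lying below some left average. Through the double
    average, every upper bound of a right average bounds these constants, so averages of small
    oscillation on either side are close to the supremum. *)
Lemma mean_exists G (F : G -> R) : ucont F -> exists m, mean F m.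
Proof.
move=> uF.
pose S := [set a | exists (I : finType) (c : I -> G),
  (0 < #|I|)%N /\ forall g, a <= lave c F g].
have S_ub (J : finType) (c' : J -> G) b : (0 < #|J|)%N ->
    (forall g, rave c' F g <= b) -> ubound S b.
  move=> J0 cb a [I [c [I0 ac]]].
  apply: (@le_trans _ _ (lave c (rave c' F) (bg_one G))).
    rewrite lave_rave -(ave_cst a J0).
    by apply: ler_ave => i; exact: ac.
  by rewrite -[leRHS](ave_cst b I0); apply: ler_ave => i; exact: cb.
have lo (e : R) : 0 < e -> exists (I : finType) (c : I -> G) (a : R),
    (0 < #|I|)%N /\ forall g, a <= lave c F g <= a + e.
  exact: lave_oscillation.
have ro (e : R) : 0 < e -> exists (I : finType) (c : I -> G) (a : R),
    (0 < #|I|)%N /\ forall g, a <= rave c F g <= a + e.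
  exact: (@lave_oscillation (opposite_group G)).
have S_sup : has_sup S.
  split.
    have [I [c [a [I0 ac]]]] := lo 1 ltr01; exists a, I, c; split => // g.
    by case/andP: (ac g).
  have [I [c [a [I0 ac]]]] := ro 1 ltr01; exists (a + 1).
  apply: (S_ub _ c) I0 _ => g.
  by case/andP: (ac g).
have r_le (J : finType) (c' : J -> G) a : (0 < #|J|)%N ->
    (forall g, a <= rave c' F g) -> a <= sup S.
  move=> J0 ca; apply/ler_addgt0Pr => e e0.
  have [I [c [a' [I0 ac]]]] := lo e e0.
  apply: (@le_trans _ _ (a' + e)); last first.
    rewrite lerD2r; apply: sup_upper_bound => //.
    by exists I, c; split=> // g; case/andP: (ac g).
  apply: (@le_trans _ _ (lave c (rave c' F) (bg_one G))).
    by rewrite -(ave_cst a I0); apply: ler_ave => i; exact: ca.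
  rewrite lave_rave -[leRHS](ave_cst _ J0).
  by apply: ler_ave => i; case/andP: (ac (bg_mul (bg_one G) (c' i))).
exists (sup S); split => e e0.
  have [I [c [a [I0 ac]]]] := lo e e0; exists I, c; split=> // g.
  have h : a <= sup S.
    apply: sup_upper_bound => //; exists I, c; split=> // h.
    by case/andP: (ac h).
  have h' : sup S <= a + e.
    apply/ler_addgt0Pr => e' e'0; have [J [c' [a' [J0 ac']]]] := ro e' e'0.
    apply: (@le_trans _ _ (a' + e')).
      apply: ge_sup; [by case: S_sup | apply: (S_ub _ c') J0 _ => h'].
      by case/andP: (ac' h').
    rewrite lerD2r.
    apply: (@le_trans _ _ (lave c (rave c' F) (bg_one G))).
      rewrite -(ave_cst a' I0); apply: ler_ave => i.
      by case/andP: (ac' (bg_mul (c i) (bg_one G))).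
    rewrite lave_rave -[leRHS](ave_cst _ J0).
    by apply: ler_ave => i; case/andP: (ac (bg_mul (bg_one G) (c' i))).
  by have /andP[? ?] := ac g; rewrite ler_distl; apply/andP; split; lra.
have [J [c [a [J0 ac]]]] := ro e e0; exists J, c; split=> // g.
have h : a <= sup S by apply: (r_le _ c) J0 _ => h; case/andP: (ac h).
have h' : sup S <= a + e.
  apply: ge_sup; [by case: S_sup | apply: (S_ub _ c) J0 _ => h'].
  by case/andP: (ac h').
by have /andP[? ?] := ac g; rewrite ler_distl; apply/andP; split; lra.
Qed.

Lemma haarP G (F : G -> R) : ucont F -> mean F (haar F).
Proof. by move=> /mean_exists[m Fm]; apply: (xgetPex 0); exists m. Qed.

Lemma haar_rmean G (F : G -> R) m : ucont F -> rmean F m -> haar F = m.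
Proof. by move=> /haarP[lF _] rm; exact: lmean_rmean_unique lF rm. Qed.

Lemma haar_lmean G (F : G -> R) m : ucont F -> lmean F m -> haar F = m.
Proof. by move=> /haarP[_ rF] lm; rewrite (lmean_rmean_unique lm rF). Qed.

Lemma eq_haar G (F F' : G -> R) : F =1 F' -> haar F = haar F'.
Proof. by move=> /funext ->. Qed.

Lemma ucontD G (F F' : G -> R) : ucont F -> ucont F' ->
  ucont (fun g => F g + F' g).
Proof.
move=> uF uF' e e0; have e2 : 0 < e / 2 by rewrite divr_gt0.
have [d d0 dF] := uF _ e2; have [d' d'0 dF'] := uF' _ e2.
exists (Num.min d d'); first by rewrite lt_min d0.
move=> x y; rewrite le_min => /andP[/dF h /dF' h'].
rewrite opprD addrACA (le_trans (ler_normD _ _))//; lra.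
Qed.

Lemma ucont_cst G (a : R) : ucont (fun _ : G => a).
Proof. by move=> e e0; exists 1 => // x y _; rewrite subrr normr0 ltW. Qed.

Lemma ucontM G (F F' : G -> R) : ucont F -> ucont F' ->
  ucont (fun g => F g * F' g).
Proof.
move=> uF uF' e e0.
have [K K0 FK] := ucont_bounded uF; have [K' K'0 FK'] := ucont_bounded uF'.
have K2 : 0 < 2 * K by rewrite mulr_gt0.
have K'2 : 0 < 2 * K' by rewrite mulr_gt0.
have [d d0 dF] := uF _ (divr_gt0 e0 K'2).
have [d' d'0 dF'] := uF' _ (divr_gt0 e0 K2).
exists (Num.min d d'); first by rewrite lt_min d0 d'0.
move=> x y; rewrite le_min => /andP[/dF h /dF' h'].
have -> : F x * F' x - F y * F' y = (F x - F y) * F' x + F y * (F' x - F' y).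
  by rewrite mulrBl mulrBr addrA subrK.
rewrite (le_trans (ler_normD _ _))// !normrM.
have := ler_pM (normr_ge0 _) (normr_ge0 _) h (FK' x).
have := ler_pM (normr_ge0 _) (normr_ge0 _) (FK y) h'.
rewrite [K * _]mulrC !invfM !mulrA !divfK ?gt_eqF//; lra.
Qed.

Lemma haar_cst G a : haar (fun _ : G => a) = a.
Proof.
apply: haar_lmean; first exact: ucont_cst.
move=> e e0; exists unit, (fun=> bg_one G); rewrite card_unit; split=> // g.
by rewrite /lave ave_cst ?card_unit// subrr normr0 ltW.
Qed.

(** One family of translates must serve both functions: averaging first makes [F] nearly constant,
    and a second averaging, chosen for [lave c F'], does not spoil this. The mean of [lave c F'] is
    that of [F'], by commutation with right averages. *)
Lemma haarD G (F F' : G -> R) : ucont F -> ucont F' ->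
  haar (fun g => F g + F' g) = haar F + haar F'.
Proof.
move=> uF uF'; have uS := ucontD uF uF'.
apply: haar_lmean => // e e0; have e2 : 0 < e / 2 by rewrite divr_gt0.
have [I [c [I0 cF]]] := (haarP uF).1 _ e2.
have uA : ucont (lave c F') by exact: ucont_lave.
have -> : haar F' = haar (lave c F').
  apply/esym/haar_rmean => // e' e'0.
  have [J [c' [J0 c'F]]] := (haarP uF').2 _ e'0.
  by exists J, c'; split => // g; rewrite -lave_rave; apply: ave_dist.
have [J [c' [J0 c'F]]] := (haarP uA).1 _ e2.
exists (J * I)%type, (fun p => bg_mul (c p.2) (c' p.1)).
split; first by rewrite card_prod muln_gt0 J0.
move=> g; rewrite -lave_comp.
have -> : lave c' (lave c (fun g => F g + F' g)) g =
    lave c' (lave c F) g + lave c' (lave c F') g.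
  by rewrite -aveD; apply: eq_ave => i; rewrite -aveD.
rewrite opprD addrACA (le_trans (ler_normD _ _))//.
have : `|lave c' (lave c F) g - haar F| <= e / 2 by apply: ave_dist.
by have := c'F g; lra.
Qed.

Lemma haarZ G a (F : G -> R) : ucont F -> haar (fun g => a * F g) = a * haar F.
Proof.
move=> uF; apply: haar_lmean; first exact: ucontM (ucont_cst _ _) uF.
have [-> e e0|a0 e e0] := eqVneq a 0.
  exists unit, (fun=> bg_one G); rewrite card_unit; split=> // g.
  by rewrite /lave aveZ !mul0r subrr normr0 ltW.
have a0' : 0 < `|a| by rewrite normr_gt0.
have [I [c [I0 cF]]] := (haarP uF).1 _ (divr_gt0 e0 a0').
exists I, c; split=> // g.
by rewrite /lave aveZ -mulrBr normrM mulrC -ler_pdivlMr//; exact: cF.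
Qed.

Lemma haar_ge0 G (F : G -> R) : ucont F -> (forall g, 0 <= F g) -> 0 <= haar F.
Proof.
move=> uF F0; apply/ler_addgt0Pr => e e0.
have [I [c [I0 /(_ (bg_one G))]]] := (haarP uF).1 _ e0.
rewrite ler_distl => /andP[_]; apply: le_trans.
by rewrite -(ave_cst 0 I0) ler_ave.
Qed.

Lemma le_haar G (F F' : G -> R) : ucont F -> ucont F' ->
  (forall g, F g <= F' g) -> haar F <= haar F'.
Proof.
move=> uF uF' FF'; rewrite -subr_ge0 -mulN1r -haarZ// -haarD//; last first.
  exact: ucontM (ucont_cst _ _) uF.
apply: haar_ge0 => [|g]; last by rewrite mulN1r subr_ge0.
by apply: ucontD => //; exact: ucontM (ucont_cst _ _) uF.
Qed.

Lemma ucontMl G (F : G -> R) k : ucont F -> ucont (fun g => F (bg_mul k g)).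
Proof.
move=> uF e e0; have [d d0 dF] := uF e e0; exists d => // x y xy.
by apply: dF; rewrite gaugeMl.
Qed.

Lemma ucontMr G (F : G -> R) k : ucont F -> ucont (fun g => F (bg_mul g k)).
Proof. exact: (@ucontMl (opposite_group G)). Qed.

Lemma haarMr G (F : G -> R) k : ucont F ->
  haar (fun g => F (bg_mul g k)) = haar F.
Proof.
move=> uF; apply: haar_lmean; first exact: ucontMr.
move=> e e0; have [I [c [I0 cF]]] := (haarP uF).1 _ e0.
exists I, c; split=> // g; have := cF (bg_mul g k).
by rewrite /lave (eq_ave (fun i => congr1 F (bg_mulA (c i) g k))).
Qed.

(* The constant is the measure of a ball, bounded below uniformly in [F]. *)
Lemma haar_ball_gt0 G (g0 : G) d : 0 < d -> exists2 k : R, 0 < k &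
  forall (F : G -> R) m, ucont F -> (forall g, 0 <= F g) ->
    (forall g, gauge g g0 <= d -> m <= F g) -> k * m <= haar F.
Proof.
move=> d0; have [I I0 /(_ g0)[c cd]] := translate_cover G d0.
exists (#|I|%:R^-1); first by rewrite invr_gt0 ltr0n.
move=> F m uF F0 Fm.
apply/ler_addgt0Pr => e e0.
have [J [c' [J0 c'F]]] := (haarP uF).2 _ e0.
have : lave c (rave c' F) (bg_one G) <= haar F + e.
  have /(_ I0) := @ave_dist _ I _ (haar F) e _
    (fun i => c'F (bg_mul (c i) (bg_one G))).
  by rewrite ler_distl => /andP[].
apply: le_trans; rewrite lave_rave -(ave_cst (_ * m) J0); apply: ler_ave => j.
(* Among the left translates of any point one falls into the ball, and the other terms are
   nonnegative. *)
have [i ig] := cd (bg_mul (bg_one G) (c' j)).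
rewrite /lave /ave (bigD1 i)//= mulrC ler_wpM2r ?invr_ge0 ?ler0n//.
by apply: le_trans (Fm _ ig) _; rewrite lerDl sumr_ge0.
Qed.

End HaarMean.

(** * Means over stabilizers in the orthogonal group *)

Section SquaredNorm.
Context {R : realType}.

(** Squared Frobenius norm; a gauge need not satisfy the triangle inequality, so no root is
    taken. *)
Definition sqn m n (A : 'M[R]_(m, n)) : R := \sum_i \sum_j A i j ^+ 2.

Lemma sqnE m n (A : 'M[R]_(m, n)) : sqn A = \tr (A *m A^T).
Proof.
apply: eq_bigr => i _; rewrite mxE; apply: eq_bigr => j _.
by rewrite mxE expr2.
Qed.

Lemma sqn_ge0 m n (A : 'M[R]_(m, n)) : 0 <= sqn A.
Proof. by do 2![apply: sumr_ge0 => ? _]; exact: sqr_ge0. Qed.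

Lemma sqn_row_le m n (A : 'M[R]_(m, n)) i : sqn (row i A) <= sqn A.
Proof.
rewrite /sqn big_ord1 (bigD1 i (P := xpredT))//=.
rewrite (eq_bigr (fun j => A i j ^+ 2)) => [|j _]; last by rewrite mxE.
by rewrite lerDl; do 2![apply: sumr_ge0 => ? _]; exact: sqr_ge0.
Qed.

Lemma sqn_entry_le m n (A : 'M[R]_(m, n)) i j : A i j ^+ 2 <= sqn A.
Proof.
rewrite /sqn (bigD1 i)//= (bigD1 j)//= -addrA lerDl addr_ge0//.
  by apply: sumr_ge0 => ? _; exact: sqr_ge0.
by do 2![apply: sumr_ge0 => ? _]; exact: sqr_ge0.
Qed.

Lemma sqn_dot n (x : 'rV[R]_n) : sqn x = dot x x.
Proof. by rewrite /sqn big_ord1; apply: eq_bigr => i _; rewrite expr2. Qed.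

Lemma dotE n (x y : 'rV[R]_n) : dot x y = (x *m y^T) 0 0.
Proof. by rewrite mxE; apply: eq_bigr => i _; rewrite mxE. Qed.

Lemma sqnMr m n (A : 'M[R]_(m, n)) (g : 'M[R]_n) :
  g *m g^T = 1%:M -> sqn (A *m g) = sqn A.
Proof. by move=> gg; rewrite !sqnE trmx_mul mulmxA -(mulmxA A) gg mulmx1. Qed.

Lemma sqnMl m n (A : 'M[R]_(m, n)) (g : 'M[R]_m) :
  g *m g^T = 1%:M -> sqn (g *m A) = sqn A.
Proof.
move=> /mulmx1C gg; rewrite !sqnE trmx_mul mxtrace_mulC !mulmxA.
by rewrite -(mulmxA A^T) gg mulmx1 mxtrace_mulC.
Qed.

Lemma sphereP n (x : 'rV[R]_n) : sphere x <-> dot x x = 1.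
Proof.
rewrite /sphere /enorm /=; split=> [h|->]; last exact: sqrtr1.
by rewrite -sqn_dot -[LHS]sqr_sqrtr ?sqn_ge0// sqn_dot h expr1n.
Qed.

End SquaredNorm.

(** * Stabilizers of a vector as totally bounded groups *)

Section StabilizerGroup.
Context {R : realType} (n : nat).

(** Matrices act on row vectors from the right. For [e = 0] this is the whole orthogonal group. *)
Definition stabmx (e : 'rV[R]_n) : pred 'M[R]_n :=
  [pred g | (g *m g^T == 1%:M) && (e *m g == e)].

Context (e : 'rV[R]_n).

Definition stab : Type := {g : 'M[R]_n | stabmx e g}.

Implicit Types (g h : stab).

Lemma stab_orth g : val g *m (val g)^T = 1%:M.
Proof. by have /andP[/eqP] := valP g. Qed.

Lemma stab_fix g : e *m val g = e.
Proof. by have /andP[_ /eqP] := valP g. Qed.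

Lemma stab_mul_subproof g h : stabmx e (val g *m val h).
Proof.
apply/andP; split; last by rewrite mulmxA !stab_fix.
by rewrite trmx_mul mulmxA -(mulmxA (val g)) stab_orth mulmx1 stab_orth.
Qed.

Lemma stab_one_subproof : stabmx e 1%:M.
Proof. by apply/andP; rewrite trmx1 !mulmx1 !eqxx. Qed.

Lemma stab_inv_subproof g : stabmx e (val g)^T.
Proof.
have gg := stab_orth g; apply/andP; split; first by rewrite trmxK (mulmx1C gg).
by rewrite -{1}(stab_fix g) -mulmxA gg mulmx1.
Qed.

Definition stab_mul g h : stab := exist (stabmx e) _ (stab_mul_subproof g h).
Definition stab_one : stab := exist (stabmx e) _ stab_one_subproof.
Definition stab_inv g : stab := exist (stabmx e) _ (stab_inv_subproof g).
Definition stab_gauge g h : R := sqn (val g - val h).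

Lemma orth_entry_le1 (g : 'M[R]_n) i j : g *m g^T = 1%:M -> `|g i j| <= 1.
Proof.
move=> gg; rewrite -(@ler_pXn2r _ 2) ?nnegrE// expr1n -normrX ger0_norm ?sqr_ge0//.
have := congr1 (fun A : 'M[R]_n => A i i) gg; rewrite !mxE eqxx mulr1n => gii.
rewrite -[leRHS]gii.
rewrite (bigD1 j)//= mxE -expr2 lerDl sumr_ge0// => k _.
by rewrite mxE -expr2 sqr_ge0.
Qed.

(** The entries lie in [-1, 1], which is cut into cells of length [1 / K]. Matrices with the same
    cells differ by at most [1 / K] in each squared entry, and [K] is chosen with [n^2 / K <= d]. *)
Lemma stab_totally_bounded (d : R) : 0 < d ->
  exists (I : finType) (c : I -> stab), forall g, exists i, stab_gauge g (c i) <= d.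
Proof.
move=> d0.
pose K := (Num.trunc ((n * n)%:R / d)).+1.
have K1 : 1 <= K%:R :> R by rewrite ler1n.
have K0 : 0 < K%:R :> R by rewrite ltr0n.
have dK : (n * n)%:R <= d * K%:R.
  by rewrite mulrC -ler_pdivrMr// ltW// truncnS_gt.
pose cell (g : stab) : {ffun 'I_n * 'I_n -> 'I_(2 * K).+1} :=
  [ffun p => inord (Num.trunc ((val g p.1 p.2 + 1) * K%:R))].
(* One representative for each inhabited pattern of cells; the identity is a default for the
   others. *)
pose c k := if pselect (exists g, cell g = k) is left gk
            then projT1 (cid gk) else stab_one.
exists {ffun 'I_n * 'I_n -> 'I_(2 * K).+1}, c => g; exists (cell g).
have ccg : cell (c (cell g)) = cell g.
  rewrite /c; case: pselect => [h|]; first exact: (projT2 (cid h)).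
  by case; exists g.
have bnd (h : stab) p : 0 <= (val h p.1 p.2 + 1) * K%:R /\
    (Num.trunc ((val h p.1 p.2 + 1) * K%:R) < (2 * K).+1)%N.
  have := orth_entry_le1 p.1 p.2 (stab_orth h); rewrite ler_norml => /andP[h1 h2].
  have h0 : 0 <= (val h p.1 p.2 + 1) * K%:R by rewrite mulr_ge0 ?(ltW K0)//; lra.
  split=> //; rewrite truncn_lt_nat// -natr1 natrM.
  apply: (@le_lt_trans _ _ (2 * K%:R)); last by rewrite ltrDl.
  rewrite ler_wpM2r ?(ltW K0)//; lra.
have entry i j : (val g i j - val (c (cell g)) i j) ^+ 2 <= K%:R^-1.
  have [g0 gK] := bnd g (i, j); have [c0 cK] := bnd (c (cell g)) (i, j).
  have := congr1 (fun k : {ffun _ -> 'I__} => nat_of_ord (k (i, j))) ccg.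
  rewrite !ffunE !inordK//= => E.
  have := Num.Theory.truncn_itv g0; have := Num.Theory.truncn_itv c0.
  rewrite /= E; set t := Num.trunc _; rewrite -natr1 => /andP[a1 a2] /andP[a3 a4].
  set x := val g i j in a3 a4 *; set y := _ i j in a1 a2 *.
  have xy : `|x - y| <= K%:R^-1.
    by rewrite -[leRHS]mul1r ler_pdivlMr// -[K%:R]gtr0_norm// -normrM ler_norml;
      apply/andP; split; lra.
  rewrite -real_normK ?num_real// expr2 (le_trans (ler_pM _ _ xy xy))//.
  by rewrite ler_piMr ?invr_ge0 ?(ltW K0)// invf_le1.
rewrite /stab_gauge /sqn.
apply: (@le_trans _ _ (\sum_(i < n) \sum_(j < n) K%:R^-1)).
  by do 2![apply: ler_sum => ? _]; rewrite !mxE; exact: entry.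
rewrite sumr_const sumr_const !card_ord -mulrnA -[leLHS]mulr_natl.
by rewrite ler_pdivrMr.
Qed.

Lemma stab_gaugeMl k g h : stab_gauge (stab_mul k g) (stab_mul k h) = stab_gauge g h.
Proof. by rewrite /stab_gauge /= -mulmxBr sqnMl ?stab_orth. Qed.

Lemma stab_gaugeMr k g h : stab_gauge (stab_mul g k) (stab_mul h k) = stab_gauge g h.
Proof. by rewrite /stab_gauge /= -mulmxBl sqnMr ?stab_orth. Qed.

Lemma stab_mulA : associative stab_mul.
Proof. by move=> x y z; apply: val_inj; exact: mulmxA. Qed.

Lemma stab_mul1 : left_id stab_one stab_mul.
Proof. by move=> x; apply: val_inj; exact: mul1mx. Qed.

Lemma stab_mulr1 : right_id stab_one stab_mul.
Proof. by move=> x; apply: val_inj; exact: mulmx1. Qed.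

Lemma stab_mulV : left_inverse stab_one stab_inv stab_mul.
Proof. by move=> x; apply: val_inj; exact/mulmx1C/stab_orth. Qed.

Lemma stab_mulrV : right_inverse stab_one stab_inv stab_mul.
Proof. by move=> x; apply: val_inj; exact: stab_orth. Qed.

Definition stab_group : bounded_group R :=
  BoundedGroup stab_mulA stab_mul1 stab_mulr1 stab_mulV stab_mulrV
    stab_gaugeMl stab_gaugeMr stab_totally_bounded.

Definition stab_haar (F : 'M[R]_n -> R) : R :=
  haar (fun g : stab_group => F (val g)).

End StabilizerGroup.

(** * Means of functions of an orthogonal matrix *)

Section MatrixMeans.
Context {R : realType} {n : nat}.
Implicit Types (F : 'M[R]_n -> R) (e : 'rV[R]_n).

(** Posed on the stabilizer of [0], the whole orthogonal group, so that it restricts to every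
    stabilizer. *)
Definition ucontmx F :=
  ucont (fun g : stab_group (0 : 'rV[R]_n) => F (val g)).

Lemma stabmx0 (g : 'M[R]_n) : g *m g^T = 1%:M -> stabmx 0 g.
Proof. by move=> gg; apply/andP; rewrite gg mul0mx !eqxx. Qed.

Lemma ucontmxP F : ucontmx F <-> forall d : R, 0 < d -> exists2 r : R, 0 < r &
  forall g h : 'M[R]_n, g *m g^T = 1%:M -> h *m h^T = 1%:M ->
    sqn (g - h) <= r -> `|F g - F h| <= d.
Proof.
split=> uF d d0; have [r r0 rF] := uF d d0; exists r => //.
  move=> g h /stabmx0 sg /stabmx0 sh.
  exact: rF (exist (stabmx 0) g sg) (exist (stabmx 0) h sh).
by move=> g h; apply: rF; exact: stab_orth.
Qed.

Lemma ucontmx_stab e F : ucontmx F ->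
  ucont (fun g : stab_group e => F (val g)).
Proof.
move=> /ucontmxP uF d d0; have [r r0 rF] := uF d d0; exists r => // g h.
by apply: rF; exact: stab_orth.
Qed.

Lemma ucontmxD F F' : ucontmx F -> ucontmx F' -> ucontmx (fun g => F g + F' g).
Proof. exact: ucontD. Qed.

Lemma ucontmxM F F' : ucontmx F -> ucontmx F' -> ucontmx (fun g => F g * F' g).
Proof. exact: ucontM. Qed.

Lemma ucontmx_cst (a : R) : ucontmx (fun=> a).
Proof. exact: ucont_cst. Qed.

Lemma ucontmxX F k : ucontmx F -> ucontmx (fun g => F g ^+ k).
Proof.
move=> uF; elim: k => [|k IH]; first exact: ucontmx_cst.
by under eq_fun do rewrite exprS; exact: ucontmxM uF IH.
Qed.

Lemma ucontmx_sum (I : finType) (F : I -> 'M[R]_n -> R) :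
  (forall i, ucontmx (F i)) -> ucontmx (fun g => \sum_i F i g).
Proof.
move=> uF; elim: (index_enum I) => [|i s IH].
  by under eq_fun do rewrite big_nil; exact: ucontmx_cst.
by under eq_fun do rewrite big_cons; exact: ucontmxD (uF _) IH.
Qed.

Lemma ucontmx_entry i j : ucontmx (fun g => g i j).
Proof.
apply/ucontmxP => d d0; exists (d ^+ 2); first by rewrite exprn_gt0.
move=> g h _ _ gh; rewrite -(@ler_pXn2r _ 2) ?nnegrE ?(ltW d0)//.
rewrite real_normK ?num_real//; apply: le_trans gh.
by have := sqn_entry_le (g - h) i j; rewrite !mxE.
Qed.

Lemma ucontmxMr F (k : 'M[R]_n) : k *m k^T = 1%:M -> ucontmx F ->
  ucontmx (fun g => F (g *m k)).
Proof.
move=> /stabmx0 sk.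
exact: (@ucontMr _ (stab_group 0) (fun g => F (val g)) (exist (stabmx 0) k sk)).
Qed.

Lemma eq_stab_haar e F F' : (forall g, stabmx e g -> F g = F' g) ->
  stab_haar e F = stab_haar e F'.
Proof. by move=> FF'; apply: eq_haar => g; exact: FF' (valP g). Qed.

Lemma stab_haarD e F F' : ucontmx F -> ucontmx F' ->
  stab_haar e (fun g => F g + F' g) = stab_haar e F + stab_haar e F'.
Proof. by move=> /(ucontmx_stab e) uF /(ucontmx_stab e) uF'; exact: haarD. Qed.

Lemma stab_haarZ e a F : ucontmx F ->
  stab_haar e (fun g => a * F g) = a * stab_haar e F.
Proof. by move=> /(ucontmx_stab e) uF; exact: haarZ. Qed.

Lemma stab_haarB e F F' : ucontmx F -> ucontmx F' ->
  stab_haar e (fun g => F g - F' g) = stab_haar e F - stab_haar e F'.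
Proof.
move=> uF uF'; rewrite -mulN1r -stab_haarZ// -stab_haarD//.
  by apply: eq_stab_haar => g _; rewrite mulN1r.
exact: ucontmxM (ucontmx_cst _) uF'.
Qed.

Lemma stab_haar_sum e (I : finType) (F : I -> 'M[R]_n -> R) :
  (forall i, ucontmx (F i)) ->
  stab_haar e (fun g => \sum_i F i g) = \sum_i stab_haar e (F i).
Proof.
move=> uF; elim: (index_enum I) => [|i s IH].
  by under eq_fun do rewrite big_nil; rewrite big_nil; exact: haar_cst.
under eq_fun do rewrite big_cons; rewrite big_cons -IH stab_haarD//.
elim: s {IH} => [|j s IH].
  by under eq_fun do rewrite big_nil; exact: ucontmx_cst.
by under eq_fun do rewrite big_cons; exact: ucontmxD (uF _) IH.
Qed.

Lemma stab_haar_cst e a : stab_haar e (fun=> a) = a.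
Proof. exact: haar_cst. Qed.

Lemma le_stab_haar e F F' : ucontmx F -> ucontmx F' ->
  (forall g, stabmx e g -> F g <= F' g) -> stab_haar e F <= stab_haar e F'.
Proof.
move=> /(ucontmx_stab e) uF /(ucontmx_stab e) uF' FF'; apply: le_haar => // g.
exact: FF' (valP g).
Qed.

Lemma stab_haarMr e F k : stabmx e k -> ucontmx F ->
  stab_haar e (fun g => F (g *m k)) = stab_haar e F.
Proof.
move=> sk /(ucontmx_stab e) uF.
exact: (haarMr (exist (stabmx e) k sk : stab_group e) uF).
Qed.

Lemma stab_haar_ball e (g0 : 'M[R]_n) d : stabmx e g0 -> 0 < d ->
  exists2 k : R, 0 < k & forall F m, ucontmx F ->
    (forall g, stabmx e g -> 0 <= F g) ->
    (forall g, stabmx e g -> sqn (g - g0) <= d -> m <= F g) ->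
    k * m <= stab_haar e F.
Proof.
move=> sg0 d0.
have [k k0 kP] := haar_ball_gt0 (exist (stabmx e) g0 sg0 : stab_group e) d0.
exists k => // F m /(ucontmx_stab e) uF F0 Fm; apply: kP => // g.
  exact: F0 (valP g).
exact: Fm (valP g).
Qed.

(* Right averages of [F] satisfy the same hypothesis and approximate the mean
   of [F] uniformly on the whole group, in particular on the stabilizer. *)
Lemma stab_haar_fubini e F : ucontmx F ->
  (forall g : 'M[R]_n, g *m g^T = 1%:M -> stab_haar e (fun h => F (h *m g)) = 0) ->
  stab_haar 0 F = 0.
Proof.
move=> uF F0; apply/eqP; rewrite -normr_le0; apply/ler_addgt0Pr => d d0.
rewrite add0r; have [I [c [I0 cF]]] := (haarP uF).2 _ d0.
pose A (h : 'M[R]_n) := ave (fun i => F (h *m val (c i))).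
have A0 : stab_haar e A = 0.
  have -> : A = fun h => #|I|%:R^-1 * \sum_i F (h *m val (c i)).
    by apply/funext => h; rewrite mulrC.
  have uA i : ucontmx (fun h => F (h *m val (c i))).
    by apply: ucontmxMr => //; exact: stab_orth.
  rewrite stab_haarZ ?stab_haar_sum//; last exact: ucontmx_sum.
  by rewrite big1 ?mulr0// => i _; apply: F0; exact: stab_orth.
have uA : ucontmx A.
  move=> r r0; have [r' r'0 r'F] := uF r r0; exists r' => // x y xy.
  apply: ave_dist2 => // i.
  by apply: (r'F (stab_mul x (c i)) (stab_mul y (c i))); rewrite /= stab_gaugeMr.
have bnd (g : 'M[R]_n) : stabmx e g -> `|A g - stab_haar 0 F| <= d.
  move=> /andP[/eqP gg _].
  exact: cF (exist (stabmx 0) g (stabmx0 gg) : stab_group 0).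
rewrite ler_norml; apply/andP; split.
  suff : stab_haar e A <= stab_haar 0 F + d by rewrite A0; lra.
  rewrite -{1}[leRHS](stab_haar_cst e); apply: le_stab_haar => //.
    exact: ucontmx_cst.
  by move=> g /bnd; rewrite ler_distl => /andP[].
suff : stab_haar 0 F - d <= stab_haar e A by rewrite A0; lra.
rewrite -{1}[leLHS](stab_haar_cst e); apply: le_stab_haar => //.
  exact: ucontmx_cst.
by move=> g /bnd; rewrite ler_distl => /andP[].
Qed.

Lemma dotC (x y : 'rV[R]_n) : dot x y = dot y x.
Proof. by apply: eq_bigr => i _; rewrite mulrC. Qed.

Lemma dotBl (x y z : 'rV[R]_n) : dot (x - y) z = dot x z - dot y z.
Proof. by rewrite !dotE mulmxBl !mxE. Qed.

Lemma dotDl (x y z : 'rV[R]_n) : dot (x + y) z = dot x z + dot y z.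
Proof. by rewrite !dotE mulmxDl !mxE. Qed.

Lemma dotZl a (x y : 'rV[R]_n) : dot (a *: x) y = a * dot x y.
Proof. by rewrite !dotE -scalemxAl mxE. Qed.

Lemma dot_eq0 (x : 'rV[R]_n) : dot x x = 0 -> x = 0.
Proof.
move=> x0; apply/rowP => i; apply/eqP; rewrite mxE -sqrf_eq0 eq_le sqr_ge0 andbT.
by apply: le_trans (sqn_entry_le x 0 i) _; rewrite sqn_dot x0.
Qed.

(** Householder reflection in the hyperplane orthogonal to [y - z], or the identity if [y = z]. *)
Lemma reflection_exists (y z : 'rV[R]_n) : dot y y = dot z z ->
  exists k : 'M[R]_n, [/\ k *m k^T = 1%:M, k^T = k, y *m k = z &
    forall x, dot x (y - z) = 0 -> x *m k = x].
Proof.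
move=> yz; have [->|yz0] := eqVneq y z.
  by exists 1%:M; split=> [||| x _]; rewrite ?trmx1 ?mulmx1.
pose v := y - z; pose q := dot v v.
have q0 : q != 0.
  by apply/eqP => /dot_eq0/eqP; rewrite subr_eq0 (negbTE yz0).
pose k : 'M[R]_n := 1%:M - (2 / q) *: (v^T *m v).
have kv x : x *m k = x - (2 / q * dot x v) *: v.
  rewrite mulmxBr mulmx1 -scalemxAr mulmxA [x *m v^T]mx11_scalar -dotE.
  by rewrite mul_scalar_mx scalerA.
have kT : k^T = k.
  by rewrite /k linearB linearZ /= trmx1 trmx_mul trmxK.
have yv : dot y v = q / 2.
  rewrite /q /v dotBl !(dotC _ (y - z)) !dotBl (dotC z y) -yz; lra.
exists k; split => //.
- rewrite kT; apply/row_matrixP => i; rewrite row_mul row1 rowE.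
  rewrite (kv (_ *m k)) kv; set x := delta_mx _ _.
  have -> : dot (x - (2 / q * dot x v) *: v) v = - dot x v.
    by rewrite dotBl dotZl -/q mulrAC divfK//; lra.
  by rewrite mulrN scaleNr opprK subrK.
- by rewrite kv yv mulrA divfK// divff ?pnatr_eq0// scale1r opprB addrC subrK.
- by move=> x xv; rewrite kv xv mulr0 scale0r subr0.
Qed.

End MatrixMeans.

(** * Quadratic forms invariant under a complete group *)

Section EuclideanNorm.
Context {R : realType} {n : nat}.
Implicit Types x y : 'rV[R]_n.

Lemma dot_ge0 x : 0 <= dot x x.
Proof. by rewrite -sqn_dot sqn_ge0. Qed.

Lemma enorm_ge0 x : 0 <= enorm x.
Proof. exact: sqrtr_ge0. Qed.

Lemma enorm_sqr x : enorm x ^+ 2 = dot x x.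
Proof. by rewrite sqr_sqrtr ?dot_ge0. Qed.

Lemma enormZ a x : enorm (a *: x) = `|a| * enorm x.
Proof.
by rewrite /enorm dotZl dotC dotZl mulrA -expr2 sqrtrM ?sqr_ge0// sqrtr_sqr.
Qed.

Lemma enorm_gt0 x : (0 < enorm x) = (x != 0).
Proof.
rewrite sqrtr_gt0 lt_def dot_ge0 andbT; congr (~~ _).
by apply/eqP/eqP => [/dot_eq0//|->]; rewrite dotE mul0mx mxE.
Qed.

(** A crude constant is enough: it only serves to make [A + a] coercive for large [a]. *)
Lemma quadratic_form_bound (A : 'M[R]_n) x :
  `|dot (x *m A) x| <= (\sum_i \sum_j `|A j i|) * dot x x.
Proof.
rewrite /dot mulr_suml (le_trans (ler_norm_sum _ _ _))//; apply: ler_sum => i _.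
rewrite mxE !mulr_suml (le_trans (ler_norm_sum _ _ _))//; apply: ler_sum => j _.
rewrite (mulrC (x 0 j)) -mulrA normrM ler_wpM2l// -/(dot x x) -sqn_dot ler_norml.
have := sqn_entry_le x 0 i; have := sqn_entry_le x 0 j.
have := sqr_ge0 (x 0 i - x 0 j); have := sqr_ge0 (x 0 i + x 0 j).
by rewrite !expr2 => *; apply/andP; split; nra.
Qed.

End EuclideanNorm.

Section InvariantForm.
Context {R : realType} {n : nat} (H : {vspace 'rV[R]_n}).
Context (G : set (subvs_of H -> subvs_of H)) (A : 'M[R]_n).
Hypothesis (Gcomplete : complete_group G) (Glinear : G `<=` @OG R n H).
Hypothesis A_stable : forall x, x \in H -> x *m A \in H.
Hypothesis A_comm : forall T, G T -> forall x y : subvs_of H,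
  vsval y = vsval x *m A -> vsval (T y) = vsval (T x) *m A.

Let L (a : R) : 'End(subvs_of H) :=
  linfun (vsproj H \o mulmxr (A + a%:M) \o vsval).

Let LE a x : vsval (L a x) = vsval x *m A + a *: vsval x.
Proof.
rewrite lfunE /= mulmxDr mul_mx_scalar vsprojK// memvD ?memvZ ?subvsP//.
by rewrite A_stable ?subvsP.
Qed.

Let K : R := \sum_i \sum_j `|A j i|.

(** The form of [A] is at least [- K |x|^2], so adding [a >= K + 1] leaves at least [|x|^2]. *)
Let L_coercive (a : R) x : K + 1 <= a ->
  dot (vsval x) (vsval x) <= dot (vsval (L a x)) (vsval x).
Proof.
move=> Ka; rewrite LE dotDl dotZl.
have := quadratic_form_bound A (vsval x); rewrite -/K ler_norml => /andP[+ _].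
have := dot_ge0 (vsval x); nra.
Qed.

Let L_inj (a : R) x : K + 1 <= a -> L a x = 0 -> x = 0.
Proof.
move=> Ka Lx; apply: subvs_inj; apply: dot_eq0; apply/eqP.
rewrite eq_le dot_ge0 andbT (le_trans (L_coercive x Ka))// Lx.
by rewrite dotE linear0 mul0mx mxE.
Qed.

Let L_surj (a : R) y : K + 1 <= a -> exists x, L a x = y.
Proof.
move=> Ka; exists ((L a)^-1 y)%VF; apply: lker0_lfunVK.
by apply/lker0P => x z /eqP; rewrite -subr_eq0 -linearB => /eqP/(L_inj Ka)/eqP;
  rewrite subr_eq0 => /eqP.
Qed.

Let E (a : R) : set (subvs_of H) := [set 0 + L a x | x in eball 0 1].

Let ballE c r (x : subvs_of H) : eball c r x = (enorm (vsval (x - c)) <= r) :> Prop.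
Proof. by []. Qed.

Let eball0P r (x : subvs_of H) : eball 0 r x <-> enorm (vsval x) <= r.
Proof. by rewrite ballE subr0. Qed.

Let E_ball (a : R) : K + 1 <= a -> Defs.is_ball (E a).
Proof.
move=> Ka; apply: Gcomplete.2.
- by exists 0, (L a).
(* The unit ball lies in [E a]: if [L a x = y], coercivity gives [|x|^2 <= <y, x>], and expanding
   [|x - y|^2 >= 0] yields [|x| <= |y|]. *)
- exists 0, 1 => // y /eball0P y1.
  have [x xy] := L_surj y Ka; exists x; last by rewrite add0r.
  apply/eball0P; rewrite -(@ler_pXn2r _ 2) ?nnegrE ?enorm_ge0// expr1n.
  have : dot (vsval y) (vsval y) <= 1.
    by rewrite -enorm_sqr expr_le1// enorm_ge0.
  have := L_coercive x Ka; rewrite xy enorm_sqr.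
  have := dot_ge0 (vsval x - vsval y).
  rewrite dotBl !(dotC _ (_ - _)) !dotBl (dotC (vsval y) (vsval x)); lra.
- move=> T GT; have [[bT dT] lT] := Glinear GT.
  have nT := ((edist_linear lT).1 (conj bT dT)).2.
  have TL x : T (L a x) = L a (T x).
    have Tlin (b : R) x1 x2 : T (b *: x1 + x2) = b *: T x1 + T x2 by exact: lT.
    have vp : vsval (vsproj H (vsval x *m A)) = vsval x *m A.
      by rewrite vsprojK// A_stable ?subvsP.
    have -> : L a x = a *: x + vsproj H (vsval x *m A).
      by apply: subvs_inj; rewrite LE addrC /= vp.
    by apply: subvs_inj; rewrite Tlin LE addrC /=; congr (_ + _); exact: A_comm.
  split; first by split.
  apply/seteqP; split=> [_ [_ [x x1 <-] <-]|_ [x x1 <-]].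
    exists (T x); last by rewrite !add0r TL.
    by apply/eball0P; rewrite nT; apply/eball0P.
  have [T' TT' T'T] := bT.
  exists (0 + L a (T' x)); last by rewrite !add0r TL T'T.
  exists (T' x) => //.
  by apply/eball0P; rewrite -nT T'T; apply/eball0P.
Qed.

Let L_conformal (a : R) : K + 1 <= a -> exists r : R, forall x,
  dot (vsval (L a x)) (vsval (L a x)) = r * dot (vsval x) (vsval x).
Proof.
move=> Ka; have [c [r r0 EB]] := E_ball Ka.
have E_opp x : E a x -> E a (- x).
  move=> [y y1 <-]; exists (- y); last by rewrite !add0r linearN.
  by apply/eball0P; rewrite linearN -scaleN1r enormZ normrN1 mul1r; apply/eball0P.
(* Otherwise the point of the ball farthest from 0 would have its opposite at distance [2 |c| + r]
   from [c], although [E a] is symmetric. *)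
have c0 : c = 0.
  apply/eqP/negPn/negP => c0.
  have p0 : 0 < enorm (vsval c).
    rewrite enorm_gt0; apply: contra c0 => /eqP c0; apply/eqP; exact: subvs_inj.
  have : E a (c + (r / enorm (vsval c)) *: c).
    rewrite EB ballE addrAC subrr add0r linearZ /= enormZ.
    by rewrite ger0_norm ?divr_ge0 ?(ltW r0) ?(ltW p0)// divfK ?gt_eqF.
  move=> /E_opp; rewrite EB ballE.
  set s := r / _; have s0 : 0 < s by rewrite divr_gt0.
  have -> : - (c + s *: c) - c = - (2 + s) *: c.
    by rewrite scaleNr scalerDl -opprD scaler_nat mulr2n addrAC.
  rewrite linearZ /= enormZ normrN ger0_norm; last by lra.
  by rewrite mulrDl /s divfK ?gt_eqF//; lra.
rewrite {}c0 in EB.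
exists (r ^+ 2) => x; have [->|x0] := eqVneq x 0.
  by rewrite !linear0 !dotE !mul0mx !mxE mulr0.
have vne (z : subvs_of H) : z != 0 -> 0 < enorm (vsval z).
  by rewrite enorm_gt0; apply: contra => /eqP z0; apply/eqP; exact: subvs_inj.
have p0 := vne x x0.
have q0 : 0 < enorm (vsval (L a x)).
  by apply: vne; apply: contra x0 => /eqP /(L_inj Ka) ->.
set p := enorm (vsval x) in p0 *; set q := enorm _ in q0.
rewrite -!enorm_sqr -/p -/q -exprMn; congr (_ ^+ 2).
(* The image of the unit vector along [x] lies in the ball, so [q <= r * p]. Conversely the boundary
   point [(r / q) *: L a x] comes from the unit ball, and by injectivity its preimage is
   [(r / q) *: x]. *)
apply/eqP; rewrite eq_le; apply/andP; split.
  have : E a (L a (p^-1 *: x)).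
    exists (p^-1 *: x); last by rewrite add0r.
    by apply/eball0P; rewrite linearZ /= enormZ ger0_norm ?invr_ge0 ?(ltW p0)//
      mulVf ?gt_eqF.
  rewrite EB => /eball0P; rewrite !linearZ /= enormZ ger0_norm ?invr_ge0 ?(ltW p0)//.
  by rewrite mulrC ler_pdivrMr.
have : eball 0 r ((r / q) *: L a x).
  apply/eball0P; rewrite linearZ /= enormZ ger0_norm ?divr_ge0 ?(ltW r0) ?(ltW q0)//.
  by rewrite divfK ?gt_eqF.
rewrite -EB => -[z z1]; rewrite add0r => zx.
have : z = (r / q) *: x.
  apply/eqP; rewrite -subr_eq0; apply/eqP/(L_inj Ka).
  by rewrite linearB linearZ /= zx subrr.
move=> zE; move/eball0P: z1; rewrite zE linearZ /= enormZ.
rewrite ger0_norm ?divr_ge0 ?(ltW r0) ?(ltW q0)// mulrAC.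
by rewrite ler_pdivrMr// mul1r.
Qed.

(* [A] commutes with [G], hence so does [A + a], whose image of the unit ball
   is then a [G]-invariant ellipsoid, so a ball; thus [A + a] is conformal for
   every large [a], and comparing two values of [a] isolates the form of [A]. *)
Lemma complete_invariant_form : exists c : R, forall x, x \in H ->
  dot (x *m A) x = c * dot x x.
Proof.
have [r rP] := @L_conformal (K + 1) (lexx _).
have [s sP] : exists s : R, forall x,
    dot (vsval (L (K + 2) x)) (vsval (L (K + 2) x)) = s * dot (vsval x) (vsval x).
  by apply: L_conformal; lra.
(* Subtracting [|(A + K + 1) x|^2] from [|(A + K + 2) x|^2] leaves
   [2 <A x, x> + (2 K + 3) |x|^2]. *)
exists ((s - r - 2 * K - 3) / 2) => x Hx.
have := rP (vsproj H x); have := sP (vsproj H x).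
rewrite !LE vsprojK// !dotDl !(dotC _ (_ + _)) !dotDl !dotZl !(dotC x (_ *: _)).
rewrite !(dotC _ (_ *: _)) !dotZl (dotC x (x *m A)) ; lra.
Qed.

End InvariantForm.

(** * First and second moments on an equator *)

Section InnerMeans.
Context {R : realType} {n : nat}.
Implicit Types (u x y : 'rV[R]_n) (f : 'rV[R]_n -> R).

Lemma dot_mulmx x y (k : 'M[R]_n) : dot (x *m k) y = dot x (y *m k^T).
Proof. by rewrite !dotE trmx_mul trmxK mulmxA. Qed.

Lemma dot_delta x i : dot x (delta_mx 0 i) = x 0 i.
Proof.
rewrite /dot (bigD1 i)//= big1 => [|j ji]; first by rewrite mxE !eqxx mulr1 addr0.
by rewrite mxE eqxx (negbTE ji) mulr0.
Qed.

Lemma dot_inj x y : (forall z, dot x z = dot y z) -> x = y.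
Proof. by move=> xy; apply/rowP => i; rewrite -!dot_delta. Qed.

Lemma dot_row (g h : 'M[R]_n) i j : dot (row i g) (row j h) = (g *m h^T) i j.
Proof. by rewrite mxE; apply: eq_bigr => k _; rewrite !mxE. Qed.

Lemma isometry_orth (k : 'M[R]_n) :
  (forall x, dot (x *m k) (x *m k) = dot x x) -> k *m k^T = 1%:M.
Proof.
move=> kP; have kxy x y : dot (x *m k) (y *m k) = dot x y.
  have := kP (x + y); rewrite mulmxDl !dotDl !(dotC _ (_ + _)) !dotDl !kP.
  by rewrite (dotC (y *m k) (x *m k)) (dotC y x); lra.
apply/matrixP => i j; rewrite -dot_row !rowE kxy dot_delta !mxE eqxx /=.
by rewrite eq_sym.
Qed.

(** Extend [T] by the identity on the line of [u]: project off [u], apply [T], then restore the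
    component along [u]. *)
Lemma perp_isometry_mx u (T : subvs_of (perp u) -> subvs_of (perp u)) :
  dot u u = 1 -> OG T -> exists k : 'M[R]_n,
  [/\ k *m k^T = 1%:M, u *m k = u & forall z, vsval (T z) = vsval z *m k].
Proof.
move=> u1 [[bT dT] lT].
have nT := ((edist_linear lT).1 (conj bT dT)).2.
pose T' : {linear subvs_of (perp u) -> subvs_of (perp u)} :=
  HB.pack T (GRing.isLinear.Build _ _ _ _ T lT).
pose k := (1%:M - u^T *m u) *m lin1_mx (vsval \o T' \o vsproj (perp u)) + u^T *m u.
have uuE x : x *m (u^T *m u) = dot x u *: u.
  by rewrite mulmxA [x *m u^T]mx11_scalar -dotE mul_scalar_mx.
have kE x : x *m k = vsval (T (vsproj (perp u) (x - dot x u *: u))) + dot x u *: u.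
  by rewrite mulmxDr uuE (mulmxA x) mul_rV_lin1 /= mulmxBr mulmx1 uuE.
have proj x : x - dot x u *: u \in perp u.
  by rewrite mem_perp dotBl dotZl u1 mulr1 subrr.
have perpTu z : dot (vsval (T z)) u = 0.
  by apply/eqP; rewrite -mem_perp subvsP.
exists k; split.
- apply: isometry_orth => x; rewrite kE dotDl !(dotC _ (_ + _)) !dotDl !dotZl.
  rewrite !(dotC _ (_ *: _)) !dotZl u1 (dotC u) perpTu -enorm_sqr nT enorm_sqr.
  rewrite vsprojK// dotBl !(dotC _ (_ - _)) !dotBl !dotZl !(dotC _ (_ *: _)) !dotZl.
  by rewrite u1 (dotC u x); lra.
- rewrite kE u1 scale1r subrr linear0.
  have -> : T 0 = 0 by exact: (linear0 T').
  by rewrite linear0 add0r.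
- move=> x; rewrite kE.
  have -> : dot (vsval x) u = 0 by apply/eqP; rewrite -mem_perp subvsP.
  by rewrite scale0r subr0 addr0 vsvalK.
Qed.

Definition sphere_ucont f := forall d : R, 0 < d -> exists2 r : R, 0 < r &
  forall x y, dot x x = 1 -> dot y y = 1 -> sqn (x - y) <= r -> `|f x - f y| <= d.

Lemma ucontmx_row f i : sphere_ucont f -> ucontmx (fun g => f (row i g)).
Proof.
move=> uf; apply/ucontmxP => d d0; have [r r0 rf] := uf d d0; exists r => //.
move=> g h gg hh gh; apply: rf; rewrite ?dot_row ?gg ?hh ?mxE ?eqxx//.
by apply: le_trans gh; rewrite -linearB; exact: sqn_row_le.
Qed.

Lemma ucontmx_dot_row i x : ucontmx (fun g => dot (row i g) x).
Proof.
apply: ucontmx_sum => j; under eq_fun do rewrite mxE.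
exact: ucontmxM (ucontmx_entry _ _) (ucontmx_cst _).
Qed.

Context (f : 'rV[R]_n -> R) (i0 i1 : 'I_n) (g : 'M[R]_n).
Hypothesis n_ge3 : (3 <= n)%N.
Hypothesis i01 : i0 != i1.
Hypothesis f_ucont : sphere_ucont f.
Hypothesis f_complete : forall u, dot u u = 1 ->
  complete_group (sym_fun (fun x : subvs_of (perp u) => f (vsval x))).
Hypothesis g_orth : g *m g^T = 1%:M.

Let u := row i1 g.
(** The products [h *m g] run through the orthogonal matrices whose row [i1] is [u], so under [mu]
    the row [i0] is uniformly distributed on the equator orthogonal to [u]. *)
Let mu (F : 'M[R]_n -> R) :=
  stab_haar (delta_mx 0 i1) (fun h => F (h *m g)).
Let sym := sym_fun (fun x : subvs_of (perp u) => f (vsval x)).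

Let u1 : dot u u = 1.
Proof. by rewrite dot_row g_orth mxE eqxx. Qed.

Let mulg_orth (h : 'M[R]_n) : stabmx (delta_mx 0 i1) h ->
  (h *m g) *m (h *m g)^T = 1%:M.
Proof.
by move=> /andP[/eqP hh _]; rewrite trmx_mul mulmxA -(mulmxA h) g_orth mulmx1.
Qed.

Let row_stab (h : 'M[R]_n) : stabmx (delta_mx 0 i1) h -> row i1 (h *m g) = u.
Proof. by move=> /andP[_ /eqP he]; rewrite /u !rowE mulmxA he. Qed.

Let row_perp (h : 'M[R]_n) : stabmx (delta_mx 0 i1) h ->
  dot (row i0 (h *m g)) u = 0.
Proof.
by move=> hs; rewrite -(row_stab hs) dot_row mulg_orth// mxE (negbTE i01).
Qed.

Let row_unit (h : 'M[R]_n) : stabmx (delta_mx 0 i1) h ->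
  dot (row i0 (h *m g)) (row i0 (h *m g)) = 1.
Proof. by move=> hs; rewrite dot_row mulg_orth// mxE eqxx. Qed.

(** Multiplying [h *m g] by [k] on the right amounts to multiplying [h] by [g k g^T], which is in
    the stabilizer because [k] fixes [u]. *)
Let mu_invariant (k : 'M[R]_n) F : ucontmx F -> k *m k^T = 1%:M -> u *m k = u ->
  mu (fun a => F (a *m k)) = mu F.
Proof.
move=> uF kk uk; pose s := g *m k *m g^T.
have sP : stabmx (delta_mx 0 i1) s.
  apply/andP; split; apply/eqP.
    rewrite /s !trmx_mul trmxK -!mulmxA (mulmxA g^T) (mulmx1C g_orth) mul1mx.
    by rewrite (mulmxA k) kk mul1mx.
  by rewrite /s !mulmxA -rowE uk /u rowE -mulmxA g_orth mulmx1.
rewrite /mu -(stab_haarMr sP (F := fun h => F (h *m g))); last exact: ucontmxMr.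
apply: eq_stab_haar => h _; rewrite /s -!mulmxA (mulmx1C g_orth) mulmx1.
by rewrite !mulmxA.
Qed.

Let mu_row_invariant (k : 'M[R]_n) (F : 'rV[R]_n -> R) :
  ucontmx (fun a => F (row i0 a)) -> k *m k^T = 1%:M -> u *m k = u ->
  mu (fun a => F (row i0 a *m k)) = mu (fun a => F (row i0 a)).
Proof.
move=> uF kk uk; rewrite -(mu_invariant uF kk uk).
by apply: eq_stab_haar => h _; rewrite -row_mul.
Qed.

Let f_sym T (k : 'M[R]_n) : sym T -> (forall z, vsval (T z) = vsval z *m k) ->
  forall h : 'M[R]_n, stabmx (delta_mx 0 i1) h ->
  f (row i0 (h *m g) *m k) = f (row i0 (h *m g)).
Proof.
move=> [_ fT] Tk h hs.
have Hp : row i0 (h *m g) \in perp u by rewrite mem_perp row_perp.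
have := fT (vsproj (perp u) (row i0 (h *m g))).
by rewrite Tk vsprojK//; apply; apply/sphereP; rewrite vsprojK// row_unit.
Qed.

(** Completeness determines the form on [u^perp]; as [A] kills [u], projecting off [u] extends the
    formula to all vectors. Summing it over the standard basis gives the trace. *)
Let invariant_form (A : 'M[R]_n) : A^T = A -> u *m A = 0 ->
  (forall T (k : 'M[R]_n), sym T -> k *m k^T = 1%:M -> u *m k = u ->
    (forall z, vsval (T z) = vsval z *m k) -> A *m k = k *m A) ->
  exists c, (forall x, dot (x *m A) x = c * (dot x x - dot x u ^+ 2)) /\
    \tr A = c * (n%:R - 1).
Proof.
move=> AT uA Ak.
have symO : sym `<=` @OG R n (perp u) by move=> T [].
have dotAu x : dot (x *m A) u = 0.
  by rewrite dot_mulmx AT uA dotC dotE mul0mx mxE.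
have A_stable x : x \in perp u -> x *m A \in perp u.
  by move=> _; rewrite mem_perp dotAu.
have [|c cP] := complete_invariant_form (f_complete u1) symO A_stable.
  move=> T sT x y xy; have [k [kk uk Tk]] := perp_isometry_mx u1 (symO T sT).
  by rewrite !Tk xy -!mulmxA (Ak T).
have cx x : dot (x *m A) x = c * (dot x x - dot x u ^+ 2).
  pose w := x - dot x u *: u.
  have wA : w *m A = x *m A by rewrite mulmxBl -scalemxAl uA scaler0 subr0.
  have wu : dot w u = 0 by rewrite dotBl dotZl u1 mulr1 subrr.
  have <- : dot w w = dot x x - dot x u ^+ 2.
    by rewrite {1}/w dotBl dotZl (dotC u) wu /w dotC dotBl dotZl (dotC u); lra.
  rewrite -cP ?mem_perp ?wu// wA [RHS]dotC dotBl dotZl (dotC u) dotAu mulr0 subr0.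
  exact: dotC.
exists c; split => //.
have -> : \tr A = \sum_i c * (1 - u 0 i ^+ 2).
  apply: eq_bigr => i _; have := cx (delta_mx 0 i).
  by rewrite -rowE !dot_delta mxE mxE !eqxx (dotC _ u) dot_delta => ->.
rewrite -mulr_sumr sumrB sumr_const card_ord; congr (_ * (_ - _)).
by rewrite -[RHS]u1; apply: eq_bigr => i _; rewrite expr2.
Qed.

Let mu_ucont F : ucontmx F -> ucontmx (fun h => F (h *m g)).
Proof. exact: ucontmxMr. Qed.

Let mu_dot (F : 'M[R]_n -> R) y : ucontmx F ->
  dot (\row_k mu (fun a => F a * a i0 k)) y = mu (fun a => F a * dot (row i0 a) y).
Proof.
move=> uF; have ua k : ucontmx (fun a => F a * a i0 k).
  exact: ucontmxM uF (ucontmx_entry _ _).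
transitivity (mu (fun a => \sum_k y 0 k * (F a * a i0 k))).
  rewrite /mu stab_haar_sum => [|k].
    apply: eq_bigr => k _; rewrite mxE mulrC -stab_haarZ//.
    exact: (@mu_ucont (fun a => F a * a i0 k)).
  apply: (@mu_ucont (fun a => y 0 k * (F a * a i0 k))).
  exact: ucontmxM (ucontmx_cst _) (ua k).
apply: eq_stab_haar => h _; rewrite /dot mulr_sumr; apply: eq_bigr => k _.
by rewrite [row i0 _ 0 k]mxE [RHS]mulrA [RHS]mulrC.
Qed.

Let uf : ucontmx (fun a => f (row i0 a)).
Proof. exact: ucontmx_row. Qed.

(** The first moment vector [b] is fixed by the symmetries of the section, so [b^T b] is an
    invariant form of rank at most one. On a space of dimension [n - 1 >= 2] such a multiple of the
    scalar product is zero. *)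
Lemma mean_linear_eq0 x :
  stab_haar (delta_mx 0 i1)
    (fun h => f (row i0 (h *m g)) * dot (row i0 (h *m g)) x) = 0.
Proof.
pose b : 'rV[R]_n := \row_k mu (fun a => f (row i0 a) * a i0 k).
have bE y : dot b y = mu (fun a => f (row i0 a) * dot (row i0 a) y).
  exact: mu_dot uf.
have bu : dot b u = 0.
  rewrite bE /mu -(stab_haar_cst (delta_mx 0 i1) (0 : R)).
  by apply: eq_stab_haar => h hs; rewrite row_perp// mulr0.
have bk T (k : 'M[R]_n) : sym T -> k *m k^T = 1%:M -> u *m k = u ->
    (forall z, vsval (T z) = vsval z *m k) -> b *m k = b.
  move=> sT kk uk Tk; apply: dot_inj => y; rewrite dot_mulmx !bE.
  rewrite -(@mu_row_invariant k (fun a => f a * dot a y))//; last first.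
    exact: ucontmxM uf (ucontmx_dot_row _ _).
  apply: eq_stab_haar => h hs.
  by rewrite (f_sym sT Tk hs) dot_mulmx.
have bbE y z : dot (y *m (b^T *m b)) z = dot y b * dot b z.
  by rewrite mulmxA [y *m b^T]mx11_scalar -dotE mul_scalar_mx dotZl.
have [||T k sT kk uk Tk|c [cP trA]] := @invariant_form (b^T *m b).
- by rewrite trmx_mul trmxK.
- by rewrite mulmxA [u *m b^T]mx11_scalar -dotE dotC bu mul_scalar_mx scale0r.
- rewrite -mulmxA (bk T)// mulmxA; congr (_ *m b).
  by rewrite -{2}(bk T k)// trmx_mul mulmxA kk mul1mx.
(* Evaluation at [b] gives [|b|^4 = c |b|^2], the trace gives [|b|^2 = c (n - 1)]; if [b] were
   nonzero, then [c (n - 2) = 0] with [c = |b|^2]. *)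
have := cP b; rewrite bbE bu expr0n subr0 => bbc.
have {trA} bbn : dot b b = c * (n%:R - 1).
  by rewrite -trA mxtrace_mulC /mxtrace big_ord1 -dotE.
have [bb0|bb0] := eqVneq (dot b b) 0.
  rewrite -[LHS]/(mu (fun a => f (row i0 a) * dot (row i0 a) x)) -bE.
  by rewrite (dot_eq0 bb0) dotE mul0mx mxE.
have bc : dot b b = c by apply: (mulIf bb0).
have n3 : 3 <= n%:R :> R by rewrite (ler_nat R 3 n).
have /eqP : c * (n%:R - 2) = 0 by move: bbn; rewrite bc; lra.
rewrite mulf_eq0 -bc (negbTE bb0) /= subr_eq0 => /eqP n2.
by move: n3; rewrite n2; lra.
Qed.

(** The second moment matrix is an invariant form. Its trace is the mean of [f], since rows are unit
    vectors, so its constant of proportionality is that mean divided by [n - 1]. *)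
Lemma mean_quadratic_eq0 x : dot x x = 1 ->
  stab_haar (delta_mx 0 i1) (fun h => f (row i0 (h *m g)) *
    ((n%:R - 1) * dot (row i0 (h *m g)) x ^+ 2
     - (1 - dot (row i1 (h *m g)) x ^+ 2))) = 0.
Proof.
move=> x1.
pose A : 'M[R]_n := \matrix_(k, l) mu (fun a => f (row i0 a) * a i0 k * a i0 l).
have ufa k : ucontmx (fun a => f (row i0 a) * a i0 k).
  exact: ucontmxM uf (ucontmx_entry _ _).
have ufd y : ucontmx (fun a => f (row i0 a) * dot (row i0 a) y).
  exact: ucontmxM uf (ucontmx_dot_row _ _).
have AT : A^T = A.
  apply/matrixP => k l; rewrite !mxE.
  by apply: eq_stab_haar => h _; rewrite mulrAC.
have AE y z : dot (y *m A) z =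
    mu (fun a => f (row i0 a) * dot (row i0 a) y * dot (row i0 a) z).
  rewrite -mu_dot//; congr (dot _ z); apply/rowP => l.
  transitivity (dot (\row_k mu (fun a => (f (row i0 a) * a i0 l) * a i0 k)) y).
    rewrite !mxE /dot; apply: eq_bigr => k _; rewrite !mxE mulrC; congr (_ * _).
    by apply: eq_stab_haar => h _; rewrite mulrAC.
  rewrite mu_dot// mxE; apply: eq_stab_haar => h _; exact: mulrAC.
have uA : u *m A = 0.
  apply: dot_inj => z; rewrite AE dotE mul0mx mxE.
  rewrite /mu -(stab_haar_cst (delta_mx 0 i1) (0 : R)).
  by apply: eq_stab_haar => h hs; rewrite row_perp// mulr0 mul0r.
have [|c [cP trA]] := invariant_form AT uA.
  move=> T k sT kk uk Tk; apply/row_matrixP => i.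
  rewrite !row_mul !rowE; apply: dot_inj => z.
  rewrite dot_mulmx !AE.
  rewrite -(@mu_row_invariant k
    (fun a => f a * dot a (delta_mx 0 i *m k) * dot a z))//; last first.
    exact: ucontmxM (ufd _) (ucontmx_dot_row _ _).
  apply: eq_stab_haar => h hs.
  by rewrite (f_sym sT Tk hs) !dot_mulmx -(mulmxA _ k) kk mulmx1.
have trE : \tr A = mu (fun a => f (row i0 a)).
  rewrite /mxtrace /mu; under eq_bigr => k _ do rewrite mxE.
  rewrite -stab_haar_sum => [|k]; last first.
    apply: (@mu_ucont (fun a => f (row i0 a) * a i0 k * a i0 k)).
    exact: ucontmxM (ufa k) (ucontmx_entry _ _).
  apply: eq_stab_haar => h hs.
  rewrite -[RHS]mulr1 -(row_unit hs) /dot mulr_sumr; apply: eq_bigr => k _.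
  by rewrite ![row i0 _ 0 k]mxE mulrA.
pose F2 a := f (row i0 a) * dot (row i0 a) x * dot (row i0 a) x.
have uF2 : ucontmx F2 by exact: ucontmxM (ufd x) (ucontmx_dot_row _ _).
transitivity ((n%:R - 1) * mu F2 - (1 - dot u x ^+ 2) * mu (fun a => f (row i0 a))).
  have uf' := mu_ucont uf; have uF2' := mu_ucont uF2.
  rewrite /mu -(stab_haarZ _ _ uF2') -(stab_haarZ _ _ uf') -stab_haarB.
  - by apply: eq_stab_haar => h hs; rewrite row_stab// /F2; lra.
  - exact: ucontmxM (ucontmx_cst _) uF2'.
  - exact: ucontmxM (ucontmx_cst _) uf'.
rewrite -AE cP -trE trA x1 (dotC x); lra.
Qed.

End InnerMeans.

(** * Zonal moments *)

Section Moments.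
Context {R : realType} {n : nat}.
Context (f : 'rV[R]_n -> R) (i0 i1 : 'I_n) (x : 'rV[R]_n).
Hypothesis i01 : i0 != i1.
Hypothesis f_ucont : sphere_ucont f.
Hypothesis x1 : dot x x = 1.

Let E := stab_haar (0 : 'rV[R]_n).
Let F (g : 'M[R]_n) := f (row i0 g).
Let p (g : 'M[R]_n) := dot (row i0 g) x.
Let q (g : 'M[R]_n) := dot (row i1 g) x.
Let w (g : 'M[R]_n) : R := 1 - p g ^+ 2.

Let uF : ucontmx F. Proof. exact: ucontmx_row. Qed.
Let up : ucontmx p. Proof. exact: ucontmx_dot_row. Qed.
Let uq : ucontmx q. Proof. exact: ucontmx_dot_row. Qed.

Let uw : ucontmx w.
Proof.
have -> : w = (fun g => 1 + (-1) * p g ^+ 2).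
  by apply/funext => g; rewrite mulN1r.
exact: ucontmxD (ucontmx_cst _) (ucontmxM (ucontmx_cst _) (ucontmxX _ up)).
Qed.

(** Even moments of one coordinate of a random unit vector in the hyperplane orthogonal to the basis
    vector [i0]. *)
Definition coordinate_moment j :=
  stab_haar (delta_mx 0 i0 : 'rV[R]_n) (fun h => h i1 i1 ^+ (2 * j)).

Let uh j : ucontmx (fun h : 'M[R]_n => h i1 i1 ^+ (2 * j)).
Proof. exact/ucontmxX/ucontmx_entry. Qed.

(** The entry is at least 1/2 at squared distance at most 1/4 from the identity, and this
    neighbourhood has positive mass. *)
Lemma coordinate_moment_gt0 j : 0 < coordinate_moment j.
Proof.
have s1 : stabmx (delta_mx 0 i0) (1%:M : 'M[R]_n).
  by apply/andP; rewrite trmx1 !mulmx1 !eqxx.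
have d0 : 0 < 4^-1 :> R by rewrite invr_gt0.
have [k k0 kP] := stab_haar_ball s1 d0.
have := kP _ (2^-1 ^+ (2 * j)) (uh j); rewrite -/(coordinate_moment j).
move=> kQ; apply: lt_le_trans (kQ _ _).
- by rewrite mulr_gt0// exprn_gt0// invr_gt0.
- by move=> h _; rewrite exprM exprn_ge0// sqr_ge0.
- move=> h _ h1; have := le_trans (sqn_entry_le _ i1 i1) h1.
  rewrite !mxE eqxx mulr1n expr2 => h2.
  have h3 : 2^-1 <= h i1 i1 by move: (h i1 i1) h2 => t ?; nra.
  by rewrite lerXn2r// nnegrE ?invr_ge0//; lra.
Qed.

Lemma coordinate_moment_nincr j : coordinate_moment j.+1 <= coordinate_moment j.
Proof.
apply: le_stab_haar => // h /andP[/eqP hh _].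
have h1 := orth_entry_le1 i1 i1 hh.
rewrite mulnS exprD ler_piMl//; first by rewrite exprM exprn_ge0// sqr_ge0.
by rewrite -real_normK ?num_real// expr_le1.
Qed.

(** By invariance, a reflection fixing the basis vector [i0] brings [y] into the plane of the basis
    vectors [i0] and [i1]. The row [i1] of [h] has no component along [i0], so only the part of [y]
    of length [s] along [i1] contributes. *)
Let stab_moment j (y : 'rV[R]_n) : dot y y = 1 ->
  stab_haar (delta_mx 0 i0) (fun h : 'M[R]_n => dot (row i1 h) y ^+ (2 * j)) =
  coordinate_moment j * (1 - y 0 i0 ^+ 2) ^+ j.
Proof.
move=> y1; have i10 : i1 != i0 by rewrite eq_sym.
have dd (i k : 'I_n) : dot (delta_mx 0 i : 'rV[R]_n) (delta_mx 0 k) = (k == i)%:R.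
  by rewrite dot_delta mxE.
have s0 : 0 <= 1 - y 0 i0 ^+ 2.
  by rewrite subr_ge0 -y1 -sqn_dot sqn_entry_le.
pose s := Num.sqrt (1 - y 0 i0 ^+ 2).
have s2 : s ^+ 2 = 1 - y 0 i0 ^+ 2 by rewrite sqr_sqrtr.
pose z := y 0 i0 *: delta_mx 0 i0 + s *: delta_mx 0 i1 : 'rV[R]_n.
have dz t : dot t z = y 0 i0 * t 0 i0 + s * t 0 i1.
  by rewrite dotC dotDl !dotZl !(dotC _ t) !dot_delta.
have yz : dot y y = dot z z.
  rewrite y1 dz !mxE !eqxx (negbTE i01) (negbTE i10) /=.
  by move: s2; rewrite !expr2; lra.
have [k [kk kT yk kfix]] := reflection_exists yz.
have sk : stabmx (delta_mx 0 i0) k.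
  apply/andP; rewrite kk eqxx; split=> //; apply/eqP/kfix.
  by rewrite dotC dotBl dot_delta dotC dz !mxE !eqxx (negbTE i10) /=; lra.
rewrite -(stab_haarMr sk); last exact/ucontmxX/ucontmx_dot_row.
rewrite mulrC -stab_haarZ//; apply: eq_stab_haar => h /andP[/eqP hh /eqP he].
rewrite row_mul dot_mulmx kT yk dz !mxE.
have -> : h i1 i0 = 0.
  transitivity (dot (row i1 h) (row i0 h)); last first.
    by rewrite dot_row hh mxE (negbTE i10).
  by rewrite [row i0 h]rowE he dot_delta mxE.
by rewrite mulr0 add0r exprMn exprM s2.
Qed.

(** Conditioning on the row [i0]: multiplication by its stabilizer keeps that row, while the power
    of [q] averages by [stab_moment]. *)
Let moment_transfer (G : 'rV[R]_n -> R) j : ucontmx (fun g => G (row i0 g)) ->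
  E (fun g => G (row i0 g) * q g ^+ (2 * j)) =
  coordinate_moment j * E (fun g => G (row i0 g) * w g ^+ j).
Proof.
move=> uG; set c := coordinate_moment j.
have u1 : ucontmx (fun g => G (row i0 g) * q g ^+ (2 * j)).
  by apply: ucontmxM => //; exact: ucontmxX.
have u2 : ucontmx (fun g => G (row i0 g) * w g ^+ j).
  by apply: ucontmxM => //; exact: ucontmxX.
have u3 := ucontmxM (ucontmx_cst c) u2.
apply/eqP; rewrite -subr_eq0 -(stab_haarZ _ _ u2) -stab_haarB//; apply/eqP.
apply: (@stab_haar_fubini _ _ (delta_mx 0 i0)) => [|g gg].
  have -> : (fun g => G (row i0 g) * q g ^+ (2 * j) - c * (G (row i0 g) * w g ^+ j)) =
      (fun g => G (row i0 g) * q g ^+ (2 * j) +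
                (-1) * (c * (G (row i0 g) * w g ^+ j))).
    by apply/funext => g; rewrite mulN1r.
  exact: ucontmxD u1 (ucontmxM (ucontmx_cst _) u3).
have rw (h : 'M[R]_n) : stabmx (delta_mx 0 i0) h -> row i0 (h *m g) = row i0 g.
  by move=> /andP[_ /eqP he]; rewrite !rowE mulmxA he.
(* The coordinates of [x] in the orthonormal basis of the rows of [g]; the one of index [i0] is
   [p g]. *)
pose y := x *m g^T.
have y1 : dot y y = 1 by rewrite dot_mulmx trmxK -mulmxA (mulmx1C gg) mulmx1.
have yi : y 0 i0 = p g by rewrite /p rowE dot_mulmx dotC dot_delta.
have := stab_moment j y1; rewrite yi -/(w g) -/c => H.
have uy : ucontmx (fun h : 'M[R]_n => dot (row i1 h) y ^+ (2 * j)).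
  exact/ucontmxX/ucontmx_dot_row.
transitivity (stab_haar (delta_mx 0 i0) (fun h : 'M[R]_n =>
    G (row i0 g) * dot (row i1 h) y ^+ (2 * j) - c * (G (row i0 g) * w g ^+ j))).
  by apply: eq_stab_haar => h hs; rewrite /w /p /q rw// row_mul dot_mulmx.
rewrite stab_haarB; last exact: ucontmx_cst.
  by rewrite (stab_haarZ _ _ uy) H stab_haar_cst; lra.
exact: ucontmxM (ucontmx_cst _) uy.
Qed.

Hypothesis n_ge3 : (3 <= n)%N.
Hypothesis f_complete : forall u, dot u u = 1 ->
  complete_group (sym_fun (fun y : subvs_of (perp u) => f (vsval y))).
Hypothesis f_centered : E F = 0.

Let q_stab (g h : 'M[R]_n) : stabmx (delta_mx 0 i1) h -> q (h *m g) = q g.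
Proof. by move=> /andP[_ /eqP he]; rewrite /q !rowE mulmxA he. Qed.

(** Conditioning on the row [i1] makes [q] constant and leaves the linear moment on the equator
    orthogonal to that row. The quadratic moment is treated alike in [even_q]. *)
Let odd_q j : E (fun g => F g * p g * q g ^+ j) = 0.
Proof.
have uFp := ucontmxM uF up.
apply: (@stab_haar_fubini _ _ (delta_mx 0 i1)) => [|g gg].
  by apply: ucontmxM => //; exact: ucontmxX.
transitivity (q g ^+ j * stab_haar (delta_mx 0 i1)
    (fun h => F (h *m g) * p (h *m g))).
  rewrite -stab_haarZ; last exact: (ucontmxMr gg uFp).
  by apply: eq_stab_haar => h hs; rewrite q_stab// mulrC.
by rewrite mean_linear_eq0// mulr0.
Qed.

Let even_q j :
  E (fun g => F g * ((n%:R - 1) * p g ^+ 2 - (1 - q g ^+ 2)) * q g ^+ j) = 0.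
Proof.
have u0 : ucontmx (fun g => F g * ((n%:R - 1) * p g ^+ 2 - (1 - q g ^+ 2))).
  apply: ucontmxM => //.
  have -> : (fun g => (n%:R - 1) * p g ^+ 2 - (1 - q g ^+ 2)) =
     (fun g => ((n%:R - 1) * p g ^+ 2 + -1) + q g ^+ 2).
    by apply/funext => g; rewrite opprB addrA addrAC.
  apply: ucontmxD; last exact: ucontmxX.
  apply: ucontmxD; last exact: ucontmx_cst.
  exact: ucontmxM (ucontmx_cst _) (ucontmxX _ up).
apply: (@stab_haar_fubini _ _ (delta_mx 0 i1)) => [|g gg].
  by apply: ucontmxM => //; exact: ucontmxX.
transitivity (q g ^+ j * stab_haar (delta_mx 0 i1) (fun h => F (h *m g) *
    ((n%:R - 1) * p (h *m g) ^+ 2 - (1 - q (h *m g) ^+ 2)))).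
  rewrite -stab_haarZ; last exact: (ucontmxMr gg u0).
  by apply: eq_stab_haar => h hs; rewrite q_stab// mulrC.
by rewrite mean_quadratic_eq0// mulr0.
Qed.

Let uFw j : ucontmx (fun g => F g * w g ^+ j).
Proof. by apply: ucontmxM => //; exact: ucontmxX. Qed.

Let odd_w j : E (fun g => F g * p g * w g ^+ j) = 0.
Proof.
have := @moment_transfer (fun a => f a * dot a x) j (ucontmxM uF up).
rewrite -/F -/p [LHS](odd_q (2 * j)) => /esym/eqP.
by rewrite mulf_eq0 gt_eqF ?coordinate_moment_gt0//= => /eqP.
Qed.

(** With [p^2 = 1 - w], the bracket of [even_q] is [(n - 2) - (n - 1) w + q^2]. Transferring powers
    of [q] to powers of [w] and using induction leaves [E(F w^(j+1))] times [c (j+1) - (n - 1) c j],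
    which is negative because [c] is positive and nonincreasing. *)
Let even_w j : E (fun g => F g * w g ^+ j) = 0.
Proof.
elim: j => [|j IH].
  rewrite -[RHS]f_centered; apply: eq_stab_haar => g _.
  by rewrite expr0 mulr1.
set c := coordinate_moment; have c0 := coordinate_moment_gt0.
have T0 := moment_transfer j uF.
have T2 := moment_transfer j.+1 uF.
have uFw1 : ucontmx (fun g => F g * w g) by exact: ucontmxM.
have T1 := @moment_transfer (fun a => f a * (1 - dot a x ^+ 2)) j uFw1.
have Fq m : ucontmx (fun g => F g * q g ^+ m).
  by apply: ucontmxM => //; exact: ucontmxX.
have Fwq m : ucontmx (fun g => F g * w g * q g ^+ m).
  by apply: ucontmxM => //; exact: ucontmxX.
have H : (n%:R - 2) * E (fun g => F g * q g ^+ (2 * j)) +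
    (1 - n%:R) * E (fun g => F g * w g * q g ^+ (2 * j)) +
    E (fun g => F g * q g ^+ (2 * j.+1)) = 0.
  rewrite -(even_q (2 * j)) -!stab_haarZ// -!stab_haarD//.
  - apply: eq_stab_haar => g _; rewrite mulnS exprD /w.
    by move: (q g ^+ (2 * j)) => t; rewrite !expr2; lra.
  - exact: ucontmxD (ucontmxM (ucontmx_cst _) (Fq _))
      (ucontmxM (ucontmx_cst _) (Fwq _)).
  - exact: ucontmxM (ucontmx_cst _) (Fq _).
  - exact: ucontmxM (ucontmx_cst _) (Fwq _).
have wj : E (fun g => F g * w g * w g ^+ j) = E (fun g => F g * w g ^+ j.+1).
  by apply: eq_stab_haar => g _; rewrite exprS mulrA.
move: H; rewrite [X in _ * X + _ * _]T0 [X in _ + _ * X]T1 [X in _ + _ + X]T2.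
rewrite -/F -/w [X in c j * X]IH wj -/c mulr0 mulr0 add0r mulrA -mulrDl.
move=> /eqP; rewrite mulf_eq0 => /orP[|/eqP//].
have := coordinate_moment_nincr j; have := c0 j; rewrite -/c.
have n3 : 3 <= n%:R :> R by rewrite (ler_nat R 3 n).
by move=> a1 a2 /eqP a3; nra.
Qed.

(** Each factor [p^2 = 1 - w] splits a moment into two with a lower power of [p], hence the
    generality in [j]. *)
Let moment_even (G : 'M[R]_n -> R) : ucontmx G ->
  (forall j, E (fun g => G g * w g ^+ j) = 0) ->
  forall k j, E (fun g => G g * p g ^+ (2 * k) * w g ^+ j) = 0.
Proof.
move=> uG G0; elim=> [|k IH] j.
  by rewrite -[RHS](G0 j); apply: eq_stab_haar => g _; rewrite expr0 mulr1.
have u0 i : ucontmx (fun g => G g * p g ^+ (2 * k) * w g ^+ i).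
  by do 2![apply: ucontmxM; last exact: ucontmxX].
rewrite -[RHS](subrr 0) -{1}(IH j) -(IH j.+1) -stab_haarB//.
apply: eq_stab_haar => g _; rewrite mulnS exprD (exprS (w g)).
by move: (p g ^+ (2 * k)) (w g ^+ j) => s t; rewrite /w !expr2; lra.
Qed.

Lemma zonal_moment m : E (fun g => F g * p g ^+ m) = 0.
Proof.
rewrite -(odd_double_half m) -mul2n; case: (odd m) => /=.
  rewrite -[RHS](moment_even (ucontmxM uF up) odd_w m./2 0).
  by apply: eq_stab_haar => g _; rewrite expr0 mulr1 add1n exprS mulrA.
rewrite -[RHS](moment_even uF even_w m./2 0).
by apply: eq_stab_haar => g _; rewrite expr0 mulr1 add0n.
Qed.

(** Carrying an extra power of [p] through the induction replaces the binomial expansion. *)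
Lemma zonal_moment_shifted N : E (fun g => F g * (1 + p g) ^+ N) = 0.
Proof.
suff H m : E (fun g => F g * p g ^+ m * (1 + p g) ^+ N) = 0.
  rewrite -[RHS](H 0%N); apply: eq_stab_haar => g _.
  by rewrite expr0 mulr1.
elim: N m => [|N IH] m.
  by rewrite -[RHS](zonal_moment m); apply: eq_stab_haar => g _; rewrite mulr1.
have u0 i : ucontmx (fun g => F g * p g ^+ i * (1 + p g) ^+ N).
  apply: ucontmxM; first by apply: ucontmxM => //; exact: ucontmxX.
  exact/ucontmxX/(ucontmxD (ucontmx_cst _) up).
rewrite -[RHS](addr0 0) -{1}(IH m) -(IH m.+1) -stab_haarD//.
by apply: eq_stab_haar => g _; rewrite !exprS; move: (_ ^+ N) (_ ^+ m) => s t; lra.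
Qed.

End Moments.

(** * Concentration of zonal weights at a point *)

Section Concentration.
Context {R : realType} {n : nat} (i0 : 'I_n).

(* The weight [(1 + <a, x>)^N] concentrates at [a = x]. *)
Lemma zonal_moments_le0 (f : 'rV[R]_n -> R) (x : 'rV[R]_n) :
  sphere_ucont f -> dot x x = 1 ->
  (forall N, stab_haar 0 (fun g : 'M[R]_n =>
     f (row i0 g) * (1 + dot (row i0 g) x) ^+ N) = 0) -> f x <= 0.
Proof.
move=> uf x1 E0; rewrite leNgt; apply/negP => fx0.
pose t (g : 'M[R]_n) := dot (row i0 g) x.
pose m := f x / 2; have m0 : 0 < m by rewrite divr_gt0.
have [r r0 rf] := uf m m0.
(* On the cap [t >= 1 - d] the squared distance [2 - 2 t] to [x] is at most [2 d <= r], so [f >= m]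
   there. *)
pose d := Num.min (r / 2) 1.
have d0 : 0 < d by rewrite lt_min divr_gt0 ?ltr01.
have d1 : d <= 1 by rewrite ge_min lexx orbT.
have dr : d <= r / 2 by rewrite ge_min lexx.
have uF : ucontmx (fun g => f (row i0 g)) by exact: ucontmx_row.
have ut N : ucontmx (fun g => (1 + t g) ^+ N).
  exact/ucontmxX/(ucontmxD (ucontmx_cst _))/ucontmx_dot_row.
have [K K0 FK] := ucont_bounded uF.
have unit (g : 'M[R]_n) : stabmx 0 g -> dot (row i0 g) (row i0 g) = 1.
  by move=> /andP[/eqP gg _]; rewrite dot_row gg mxE eqxx.
have dist (g : 'M[R]_n) : stabmx 0 g -> sqn (row i0 g - x) = 2 - 2 * t g.
  move=> gs; rewrite sqn_dot dotBl !(dotC _ (_ - _)) !dotBl unit// x1.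
  by rewrite (dotC x); rewrite /t; lra.
have t_ge (g : 'M[R]_n) : stabmx 0 g -> 0 <= 1 + t g.
  move=> gs; have := dot_ge0 (row i0 g + x).
  rewrite dotDl !(dotC _ (_ + _)) !dotDl unit// x1 (dotC x); rewrite /t; lra.
(* Outside the cap, [f >= - K] and the weight is at most [(2 - d) ^+ N]. *)
have low N (g : 'M[R]_n) : stabmx 0 g ->
    m * (1 + t g) ^+ N + - ((K + m) * (2 - d) ^+ N) <= f (row i0 g) * (1 + t g) ^+ N.
  move=> gs; have := FK (exist (stabmx 0) g gs).
  rewrite ler_norml /= => /andP[fK _].
  have tN : 0 <= (1 + t g) ^+ N by rewrite exprn_ge0 ?t_ge.
  have dN : 0 <= (2 - d) ^+ N by rewrite exprn_ge0; lra.
  have [tg|tg] := lerP (1 - d) (t g).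
    have : m <= f (row i0 g).
      have := rf _ _ (unit _ gs) x1; rewrite dist// => /(_ _)/wrap[]; first by lra.
      by rewrite ler_distl /m => /andP[? _]; lra.
    move=> fm; have := ler_wpM2r tN fm.
    by have := mulr_ge0 (addr_ge0 (ltW K0) (ltW m0)) dN; lra.
  have : (1 + t g) ^+ N <= (2 - d) ^+ N.
    by rewrite lerXn2r ?nnegrE ?t_ge//; lra.
  move=> tdN.
  have : 0 <= (f (row i0 g) + K) * (1 + t g) ^+ N by rewrite mulr_ge0//; lra.
  by have := ler_wpM2l (addr_ge0 (ltW K0) (ltW m0)) tdN; lra.
have [g0 [g0g0 _ g0x _]] : exists g0 : 'M[R]_n, [/\ g0 *m g0^T = 1%:M, g0^T = g0,
    delta_mx 0 i0 *m g0 = x &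
    forall y, dot y (delta_mx 0 i0 - x) = 0 -> y *m g0 = y].
  by apply: reflection_exists; rewrite dot_delta mxE !eqxx x1.
have [k k0 kP] := stab_haar_ball (stabmx0 g0g0) d0.
(* Within squared distance [d] of [g0], whose row [i0] is [x], [t >= 1 - d / 2]. This smaller cap
   makes the weight grow faster than [(2 - d) ^+ N]. *)
have kE N : k * (2 - d / 2) ^+ N <= stab_haar 0 (fun g => (1 + t g) ^+ N).
  apply: kP => // g gs; first by rewrite exprn_ge0 ?t_ge.
  move=> gg0; have : sqn (row i0 g - x) <= d.
    apply: le_trans gg0; rewrite -g0x -rowE -linearB; exact: sqn_row_le.
  by rewrite dist// => h; rewrite lerXn2r ?nnegrE ?t_ge//; lra.
(* For large [N] the error term is at most half of the lower bound [m * k * (2 - d / 2) ^+ N], so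
   the moment would be positive. *)
pose a : R := (2 - d) / (2 - d / 2).
have b0 : 0 < 2 - d / 2 by lra.
have a01 : 0 <= a < 1.
  by rewrite divr_ge0 ?(ltW b0)// ?ltr_pdivrMr//; lra.
have mk0 : 0 < m * k / 2 by rewrite divr_gt0// mulr_gt0.
have [N] := expr_small (K + m) a01 mk0.
rewrite expr_div_n mulrA ler_pdivrMr ?exprn_gt0// => small.
have bN : 0 < (2 - d / 2) ^+ N by rewrite exprn_gt0.
have := E0 N.
have : m * stab_haar 0 (fun g => (1 + t g) ^+ N) + - ((K + m) * (2 - d) ^+ N) <=
    stab_haar 0 (fun g => f (row i0 g) * (1 + t g) ^+ N).
  rewrite -(stab_haarZ _ _ (ut N)) -(stab_haar_cst (0 : 'rV_n) (- _)) -stab_haarD.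
  - apply: le_stab_haar (low N); last exact: ucontmxM.
    exact: ucontmxD (ucontmxM (ucontmx_cst _) (ut N)) (ucontmx_cst _).
  - exact: ucontmxM (ucontmx_cst _) (ut N).
  - exact: ucontmx_cst.
move=> le1 eq0; rewrite eq0 in le1.
have := ler_wpM2l (ltW m0) (kE N).
have : 0 < m * k / 2 * (2 - d / 2) ^+ N by rewrite mulr_gt0.
lra.
Qed.

End Concentration.

(** * Uniform continuity on the sphere and conclusion *)

Lemma sphere_compact (R : realType) (n : nat) :
  compact (sphere : set 'rV[R]_n).
Proof.
apply: bounded_closed_compact.
  exists 1; split; first exact: num_real.
  move=> M M1 x /sphereP x1; rewrite /= [leLHS]/Num.Def.normr /= mx_normrE.
  apply: bigmax_le => [|[i j] _]; first by rewrite ltW// (lt_trans ltr01).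
  apply: le_trans (ltW M1); rewrite (ord1 i) -(@ler_pXn2r _ 2) ?nnegrE// expr1n.
  by rewrite real_normK ?num_real//= -x1 -sqn_dot sqn_entry_le.
have -> : sphere = (fun x : 'rV[R]_n => \sum_i x 0 i * x 0 i) @^-1` [set 1].
  by apply/seteqP; split=> x /sphereP.
apply: closed_comp => [x _|]; last exact: closed_eq.
elim: (index_enum 'I_n) => [|i s IH].
  have -> : (fun x : 'rV[R]_n => \sum_(i <- [::]) x 0 i * x 0 i) = cst (0 : R).
    by apply/funext => y; rewrite big_nil.
  exact: cst_continuous.
have -> : (fun x : 'rV[R]_n => \sum_(j <- i :: s) x 0 j * x 0 j) =
    (fun x => x 0 i * x 0 i) \+ (fun x => \sum_(j <- s) x 0 j * x 0 j).
  by apply/funext => y; rewrite big_cons.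
by apply: continuousD IH; apply: continuousM; exact: coord_continuous.
Qed.

(** Heine-Cantor by the near-covering form of compactness, the filter parameter being the radius [r]
    tending to 0 from the right. *)
Lemma sphere_ucont_continuous (R : realType) (n : nat) (f : 'rV[R]_n -> R) :
  {within (sphere : set 'rV[R]_n), continuous f} -> sphere_ucont f.
Proof.
move=> /subspace_continuousP fc d d0.
have := sphere_compact (R := R) (n := n).
rewrite compact_near_coveringP => /near_covering_withinP.
pose P (r : R) (x : 'rV[R]_n) := forall y, sphere y -> sqn (x - y) <= r ->
  `|f x - f y| <= d.
move=> /(_ R (0^'+)%R P _) H.
have {}H : \forall r \near (0 : R)^'+, sphere `<=` P r.
  apply: H => x Sx.
  have d2 : 0 < d / 2 by rewrite divr_gt0.
  have := fc x Sx; move=> /cvgrPdist_le/(_ _ d2).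
  rewrite near_withinE => /nbhs_ballP[e /= e0 eP].
  (* Balls here are for the maximum norm, which the Euclidean one dominates: squared distance below
     [(e / 2) ^+ 2] keeps [y] within [e / 2] of [x'], hence within [e] of [x]. *)
  exists (ball x (e / 2), [set r : R | 0 < r < (e / 2) ^+ 2]) => /=.
    split; first by apply: nbhsx_ballx; rewrite divr_gt0.
    near=> r; apply/andP; split=> //.
    near: r; apply: nbhs_right_lt; rewrite exprn_gt0 ?divr_gt0//.
  move=> [x' r] /= [xx' /andP[r0 re]] Sx' y Sy yr.
  have dx' : `|f x - f x'| <= d / 2.
    apply: eP => //; apply: le_ball xx'; lra.
  have dy : `|f x - f y| <= d / 2.
    apply: eP => //.
    rewrite (splitr e); apply: ball_triangle xx' _.
    rewrite -ball_normE /= [ltLHS]/Num.Def.normr /= mx_normrE.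
    apply: bigmax_lt; first by rewrite divr_gt0.
    move=> [i j] _ /=; rewrite (ord1 i).
    rewrite -(@ltr_pXn2r _ 2) ?nnegrE ?divr_ge0 ?(ltW e0)//.
    rewrite real_normK ?num_real//; apply: le_lt_trans re; apply: le_trans yr.
    exact: sqn_entry_le.
  move: dx' dy; rewrite !ler_distl => /andP[? ?] /andP[? ?].
  by apply/andP; split; lra.
near ((0 : R)^'+) => r; exists r => // x y /sphereP Sx /sphereP Sy.
by apply: (near H r _ x Sx) => //.
Unshelve. all: by end_near. Qed.

Theorem theorem1p4 (R : realType) (n : nat) (hn : (3 <= n)%N)
    (f : 'rV[R]_n -> R)
    (fcont : {within (sphere : set 'rV[R]_n), continuous f})
    (fsym : forall u : 'rV[R]_n, sphere u ->
       completely_symmetric (fun x : subvs_of (perp u) => f (vsval x))) :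
  exists c : R, forall x : 'rV[R]_n, sphere x -> f x = c.
Proof.
pose i0 : 'I_n := Ordinal (ltn_trans (isT : 0 < 2)%N hn).
pose i1 : 'I_n := Ordinal (ltn_trans (isT : 1 < 2)%N hn).
have i01 : i0 != i1 by [].
have uf := sphere_ucont_continuous fcont.
(* Subtracting the mean of [f] gives mean zero and keeps the symmetry groups of the sections. *)
pose c := stab_haar (0 : 'rV[R]_n) (fun g => f (row i0 g)).
have uh : sphere_ucont (fun x => f x - c).
  move=> d /uf[r r0 rf]; exists r => // x y x1 y1 xy.
  by rewrite opprB addrA subrK; exact: rf.
have h_complete u : dot u u = 1 -> complete_group
    (sym_fun (fun x : subvs_of (perp u) => f (vsval x) - c)).
  move=> /sphereP Su; have [_] := fsym u Su.
  congr (complete_group _); apply/seteqP; split=> T [OT fT]; split=> // x Sx.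
    by rewrite fT.
  by apply: (addIr (- c)); exact: fT.
have h0 : stab_haar (0 : 'rV[R]_n) (fun g => f (row i0 g) - c) = 0.
  rewrite stab_haarB ?stab_haar_cst ?subrr//; first exact: ucontmx_row.
  exact: ucontmx_cst.
exists c => x /sphereP x1; have M := zonal_moment_shifted i01 uh x1 hn h_complete h0.
apply/eqP; rewrite eq_le -subr_le0 (zonal_moments_le0 uh x1 M)/=.
(* Concentration gives an upper bound only; the opposite function has vanishing moments too and
   gives the lower one. *)
have uh' : sphere_ucont (fun x => - (f x - c)).
  move=> d /uh[r r0 rh]; exists r => // y z y1 z1 /(rh y z y1 z1).
  by rewrite -opprD normrN.
rewrite -subr_ge0 -oppr_le0 (zonal_moments_le0 (i0 := i0) uh' x1)// => N.
have uM : ucontmx (fun g : 'M[R]_n =>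
    (f (row i0 g) - c) * (1 + dot (row i0 g) x) ^+ N).
  apply: ucontmxM; first exact: (ucontmx_row i0 uh).
  exact/ucontmxX/(ucontmxD (ucontmx_cst _))/ucontmx_dot_row.
rewrite -[RHS](mulr0 (-1)) -(M N) -stab_haarZ//.
by apply: eq_stab_haar => g _; rewrite mulrA mulN1r.
Qed.
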